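(* Let $\lambda>1$ and let $\sigma_\lambda$ be the density-of-states measure of the graph Laplacian on Erdős--Rényi random graphs $\mathcal G(N,\lambda/N)$. Then there exist constants $E_0>0$ and $c'\ge c>0$ such that $$\exp\big(-c'E^{-1/2}\big)\le \sigma_\lambda\big((0,E]\big)\le \exp\big(-cE^{-1/2}\big)$$ for every $E\in(0,E_0]$.
   Context: For $N\in\mathbb N\setminus\{1\}$, $\mathcal G(N,\lambda/N)$ is the ensemble of Erdős--Rényi random graphs $\mathbf G^{(N)}$: simple undirected graphs on the vertices $1,\dots,N$ in which each of the $\binom N2$ possible edges is present independently with probability $\lambda/N$ (for $N$ large enough that $\lambda/N<1$). Let $\mathbb E^{(N)}_\lambda$ be the corresponding expectation. Let $A^{(N)}$ be the adjacency matrix of $\mathbf G^{(N)}$, $D^{(N)}$ the diagonal matrix of its vertex degrees, and $\Delta^{(N)}:=D^{(N)}-A^{(N)}$ the graph Laplacian, a self-adjoint $N\times N$ matrix. For a Borel set $B\subseteq\mathbb R$ define $$\sigma_\lambda^{(N)}(B):=\frac1N\,\mathbb E^{(N)}_\lambda\big[\mathrm{tr}\,\mathbf 1_B(\Delta^{(N)})\big],$$ where $\mathrm{tr}\,\mathbf 1_B(\Delta^{(N)})$ is the number of eigenvalues of $\Delta^{(N)}$ in $B$, counted with multiplicity. It is known that, for every $\lambda>0$, the probability measures $\sigma_\lambda^{(N)}$ converge weakly as $N\to\infty$ to a Borel probability measure on $\mathbb R$; this limit is the density-of-states measure $\sigma_\lambda$. *)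

(* Defs.v *)
From HB Require Import structures.
From mathcomp Require Import all_boot all_order all_algebra.
From mathcomp Require Import finmap.
From mathcomp Require Import all_classical all_reals all_analysis.

Set Implicit Arguments.
Unset Strict Implicit.
Unset Printing Implicit Defensive.

Import Order.TTheory GRing.Theory Num.Theory.
Import numFieldNormedType.Exports.

Local Open Scope classical_set_scope.
Local Open Scope ring_scope.

(* A simple graph on 'I_N is a subset of [edges N]: an edge is the unordered
   pair of its endpoints, so that there are no loops. *)
Definition edges (N : nat) : {set {set 'I_N}} :=
  [set e : {set 'I_N} | #|e| == 2]%SET.

Section Laplacian.
Variables (R : realType) (N : nat).

Definition adjacency (G : {set {set 'I_N}}) : 'M[R]_N :=
  \matrix_(i, j) ([set i; j]%SET \in G)%:R.

Definition degree (G : {set {set 'I_N}}) (i : 'I_N) : nat :=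
  #|[set j : 'I_N | [set i; j]%SET \in G]%SET|.

Definition laplacian (G : {set {set 'I_N}}) : 'M[R]_N :=
  diag_mx (\row_i (degree G i)%:R) - adjacency G.

(* For a self-adjoint A this is the trace of the spectral projection 1_B(A);
   the sum has finite support, the spectrum of A. *)
Definition eig_count (A : 'M[R]_N) (B : set R) : nat :=
  \big[addn/0%N]_(x \in B) \rank (eigenspace A x).

(* The law of G(N, p): independent Bernoulli(p) edges.  [bernoulli_prob p] is
   the Dirac mass at [false] when p lies outside [0, 1]; with p = lambda / N
   this concerns only the finitely many N < lambda. *)
Definition er_pmf (p : R) (G : {set {set 'I_N}}) : R :=
  \prod_(e in edges N) fine (bernoulli_prob p [set e \in G]).

Definition er_expectation (p : R) (X : {set {set 'I_N}} -> R) : R :=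
  \sum_(G in powerset (edges N)) er_pmf p G * X G.

End Laplacian.

Definition dos_N (R : realType) (lambda : R) (N : nat)
    (B : set (measurableTypeR R)) : \bar R :=
  (N%:R^-1 * er_expectation (lambda / N%:R)
     (fun G : {set {set 'I_N}} => (eig_count (laplacian R G) B)%:R))%:E.

Section dos_N_measure.
Variable R : realType.
Local Notation T := (measurableTypeR R).

Lemma fin_eigenvalues N (A : 'M[R]_N) : finite_set [set x | eigenvalue A x].
Proof.
have p0 : char_poly A != 0 by rewrite monic_neq0 // char_poly_monic.
apply: contrapT => /(infinite_set_fset (size (char_poly A)))[F sF cF].
have : all (root (char_poly A)) (enum_fset F).
  by apply/allP => x xF; rewrite -eigenvalue_root_char; exact: sF.
by move=> /(max_poly_roots p0)/(_ (fset_uniq F)); rewrite ltnNge cF.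
Qed.

Lemma eig_countE N (A : 'M[R]_N) (B : set T) :
  (eig_count A B)%:R%:E =
  (\sum_(x <- fset_set [set x | eigenvalue A x])
    ((\rank (eigenspace A x))%:R%:E * \d_(x : T) B) :> \bar R)%E.
Proof.
rewrite /eig_count fsbig_mkcond (fsbigTE (fset_set [set x | eigenvalue A x])).
  rewrite natr_sum -sumEFin; apply: eq_bigr => x _.
  by rewrite diracE /patch; case: ifP => _; rewrite ?mule1 ?mule0.
move=> x; rewrite (in_fset_set (fin_eigenvalues A)) notin_setE /= /patch => /negP.
by rewrite negbK => /eqP ->; rewrite mxrank0 if_same.
Qed.

Lemma wsum_sigma_additive (I : Type) (x0 : I) (s : seq I) (c : I -> {nonneg R})
    (m : I -> {measure set T -> \bar R}) :
  semi_sigma_additive (fun B : set T =>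
    \sum_(i <- s) ((c i)%:num%:E * m i B))%E.
Proof.
rewrite (_ : (fun _ => _) =
  msum (fun k => mscale (c (nth x0 s k)) (m (nth x0 s k))) (size s)).
  exact: measure_semi_sigma_additive.
by apply/funext => B; rewrite /msum /mscale (big_nth x0) big_mkord.
Qed.

Definition eig_measure N (A : 'M[R]_N) (B : set T) : \bar R :=
  (eig_count A B)%:R%:E.

Let eig_measure0 N (A : 'M[R]_N) : eig_measure A set0 = 0%E.
Proof. by rewrite /eig_measure /eig_count fsbig_set0. Qed.

Let eig_measure_ge0 N (A : 'M[R]_N) B : (0 <= eig_measure A B)%E.
Proof. by rewrite lee_fin. Qed.

Let eig_measure_sigma_additive N (A : 'M[R]_N) :
  semi_sigma_additive (eig_measure A).
Proof.
rewrite (_ : eig_measure A = fun B =>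
  (\sum_(x <- fset_set [set x | eigenvalue A x])
    ((NngNum (ler0n R (\rank (eigenspace A x))))%:num%:E * \d_(x : T) B))%E).
  exact: (wsum_sigma_additive 0).
by apply/funext => B; rewrite /eig_measure eig_countE.
Qed.

HB.instance Definition _ N (A : 'M[R]_N) := isMeasure.Build _ T R
  (eig_measure A) (eig_measure0 A) (@eig_measure_ge0 N A)
  (@eig_measure_sigma_additive N A).

Lemma er_pmf_ge0 N (p : R) (G : {set {set 'I_N}}) : 0 <= er_pmf p G.
Proof. by apply: prodr_ge0 => e _; exact: fine_ge0. Qed.

Lemma weight_ge0 (p : R) N (G : {set {set 'I_N}}) : 0 <= N%:R^-1 * er_pmf p G.
Proof. by rewrite mulr_ge0 ?invr_ge0 ?er_pmf_ge0. Qed.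

Lemma dos_NE (lambda : R) N (B : set T) : dos_N lambda N B =
  (\sum_(G <- enum (powerset (edges N)))
    ((NngNum (weight_ge0 (lambda / N%:R) G))%:num%:E
     * eig_measure (laplacian R G) B))%E.
Proof.
rewrite /dos_N /er_expectation big_enum /= mulr_sumr -sumEFin.
by apply: eq_bigr => G _; rewrite mulrA EFinM.
Qed.

Let dos_N0 (lambda : R) N : dos_N lambda N set0 = 0%E.
Proof. by rewrite dos_NE big1// => G _; rewrite measure0 mule0. Qed.

Let dos_N_ge0 (lambda : R) N B : (0 <= dos_N lambda N B)%E.
Proof. by rewrite dos_NE sume_ge0// => G _; rewrite mule_ge0// lee_fin. Qed.

Let dos_N_sigma_additive (lambda : R) N : semi_sigma_additive (dos_N lambda N).
Proof.
rewrite (funext (dos_NE lambda N)).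
exact: (wsum_sigma_additive finset.set0).
Qed.

HB.instance Definition _ (lambda : R) N := isMeasure.Build _ T R
  (dos_N lambda N) (dos_N0 lambda N) (@dos_N_ge0 lambda N)
  (@dos_N_sigma_additive lambda N).

End dos_N_measure.

Definition cvg_weakly (R : realType)
    (mu_ : nat -> {measure set (measurableTypeR R) -> \bar R})
    (mu : {measure set (measurableTypeR R) -> \bar R}) : Prop :=
  forall f : R -> R, continuous f -> bounded_fun f ->
    (\int[mu_ N]_x (f x)%:E @[N --> \oo] --> \int[mu]_x (f x)%:E)%E.

(* The density-of-states measure, as the weak limit of the [dos_N lambda N]. *)
Definition is_dos (R : realType) (lambda : R)
    (sigma : probability (measurableTypeR R) R) : Prop :=
  cvg_weakly (fun N => dos_N lambda N) sigma.

(* Main.v *)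
(** Weak convergence reduces both bounds to graphs on N vertices, N large.

Lower bound: a component that is a path with L vertices contributes the eigenvalue
2 - 2 cos(pi/L) ~ (pi/L)^2, and the expected density of such components is exponentially
small in L. Take L of order E^(-1/2).

Upper bound: let L be of order E^(-1/2). Call a connected set A of at most M vertices (M
depends on L only) bad if it contains a cycle, or if it has at least L vertices and at most
eps |A| boundary edges. That the component of a vertex in the critical graph G(N, 1/N) is
one set at most bounds the number of trees on a vertices, and a Chernoff bound for the
boundary shows that the density of vertices in bad sets is at most a constant times
(lambda e^(1 - lambda + delta))^L, which is exponentially small as lambda > 1. A component
with fewer than L vertices that is a tree has no eigenvalue in (0, E]. Away from these
components, from the bad sets and from the vertices of large degree, every set of at most M
vertices has a boundary at least 1/(3L+1) times its volume, so that by Cheeger's inequality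
<f, Delta f> >= 4 E |f|^2 for every f supported on at most M of the remaining vertices.
This local bound suffices to count eigenvalues: with 1 - Delta / (2 D) compressed to a
positive contraction T on the remaining vertices, T^k delta_x has small support, so that
its norm decays fast in k, and tr T^(2k) bounds the number of eigenvalues below E. *)

Require Import Defs.
From mathcomp Require Import finmap.
From mathcomp Require Import all_boot all_order all_algebra.
From mathcomp Require Import all_classical all_reals all_analysis.
From mathcomp Require Import measurable_realfun.
From mathcomp Require Import ring lra zify.

Set Implicit Arguments.
Unset Strict Implicit.
Unset Printing Implicit Defensive.

Import Order.TTheory GRing.Theory Num.Theory.
Import numFieldNormedType.Exports.

Local Open Scope classical_set_scope.
Local Open Scope ring_scope.

(** * Quadratic forms *)

Section Dot.
Variable R : realFieldType.

Definition dot n (u v : 'rV[R]_n) : R := \sum_i u 0 i * v 0 i.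

Lemma dotE n (u v : 'rV[R]_n) : dot u v = (u *m v^T) 0 0.
Proof. by rewrite mxE; apply: eq_bigr => i _; rewrite mxE. Qed.

Lemma dotC n (u v : 'rV[R]_n) : dot u v = dot v u.
Proof. by apply: eq_bigr => i _; rewrite mulrC. Qed.

Lemma dotDl n (u v w : 'rV[R]_n) : dot (u + v) w = dot u w + dot v w.
Proof. by rewrite -big_split; apply: eq_bigr => i _; rewrite mxE mulrDl. Qed.

Lemma dotDr n (u v w : 'rV[R]_n) : dot w (u + v) = dot w u + dot w v.
Proof. by rewrite dotC dotDl !(dotC w). Qed.

Lemma dotZl n a (u v : 'rV[R]_n) : dot (a *: u) v = a * dot u v.
Proof. by rewrite mulr_sumr; apply: eq_bigr => i _; rewrite mxE mulrA. Qed.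

Lemma dotZr n a (u v : 'rV[R]_n) : dot u (a *: v) = a * dot u v.
Proof. by rewrite dotC dotZl dotC. Qed.

Lemma dotNl n (u v : 'rV[R]_n) : dot (- u) v = - dot u v.
Proof. by rewrite -scaleN1r dotZl mulN1r. Qed.

Lemma dotBl n (u v w : 'rV[R]_n) : dot (u - v) w = dot u w - dot v w.
Proof. by rewrite dotDl dotNl. Qed.

Lemma dot_suml n I (r : seq I) (P : pred I) (F : I -> 'rV[R]_n) v :
  dot (\sum_(i <- r | P i) F i) v = \sum_(i <- r | P i) dot (F i) v.
Proof.
elim/big_rec2: _ => [|i x y _ <-]; last by rewrite dotDl.
by rewrite /dot big1 // => i _; rewrite mxE mul0r.
Qed.

Lemma dot_sumr n I (r : seq I) (P : pred I) (F : I -> 'rV[R]_n) v :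
  dot v (\sum_(i <- r | P i) F i) = \sum_(i <- r | P i) dot v (F i).
Proof. by rewrite dotC dot_suml; apply: eq_bigr => i _; rewrite dotC. Qed.

Lemma dot_ge0 n (u : 'rV[R]_n) : 0 <= dot u u.
Proof. by apply: sumr_ge0 => i _; rewrite -expr2 sqr_ge0. Qed.

Lemma dot_eq0 n (u : 'rV[R]_n) : dot u u = 0 -> u = 0.
Proof.
move=> /eqP; rewrite psumr_eq0 => [/allP u0|i _]; last by rewrite -expr2 sqr_ge0.
apply/rowP => i; rewrite mxE; apply/eqP.
by have := u0 i (mem_index_enum _); rewrite -expr2 sqrf_eq0.
Qed.

Lemma dot_mulmx n m (u : 'rV[R]_m) (A : 'M[R]_(m, n)) v :
  dot (u *m A) v = dot u (v *m A^T).
Proof. by rewrite !dotE trmx_mul trmxK mulmxA. Qed.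

Lemma dot_delta n (A : 'M[R]_n) i :
  dot (delta_mx 0 i *m A) (delta_mx 0 i) = A i i.
Proof.
rewrite /dot (bigD1 i) //= big1 => [|j ji]; last first.
  by rewrite [X in _ * X]mxE (negPf ji) andbF mulr0.
by rewrite -rowE !mxE !eqxx mulr1 addr0.
Qed.

Lemma mxtrace_ge0 n (A : 'M[R]_n) :
  (forall u, 0 <= dot (u *m A) u) -> 0 <= \tr A.
Proof. by move=> A0; apply: sumr_ge0 => i _; rewrite -dot_delta. Qed.

Section PsdForm.
Variables (n : nat) (T : 'M[R]_n).
Hypotheses (Tsym : T^T = T) (Tge0 : forall u, 0 <= dot (u *m T) u).

Lemma psd_CauchySchwarz u v :
  dot (u *m T) v ^+ 2 <= dot (u *m T) u * dot (v *m T) v.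
Proof.
have sym x y : dot (x *m T) y = dot (y *m T) x by rewrite dot_mulmx Tsym dotC.
set a := dot (u *m T) u; set b := dot (v *m T) v; set c := dot (u *m T) v.
have E t : 0 <= a + 2 * t * c + t ^+ 2 * b.
  have := Tge0 (u + t *: v).
  rewrite mulmxDl -scalemxAl !(dotDl, dotDr, dotZl, dotZr) (sym v u) -/a -/b -/c.
  by congr (_ <= _); ring.
have [b0|b0] := eqVneq b 0.
  rewrite b0 mulr0; have [->|c0] := eqVneq c 0; first by rewrite expr0n.
  (* With b = 0 the form is affine in t, and at this t it would equal -1. *)
  have := E (- (a + 1) / (2 * c)); rewrite b0 mulr0 addr0.
  suff -> : 2 * (- (a + 1) / (2 * c)) * c = - (a + 1) by lra.
  by field.
have bp : 0 < b by rewrite lt_neqAle eq_sym b0 Tge0.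
have := E (- c / b).
have -> : a + 2 * (- c / b) * c + (- c / b) ^+ 2 * b = (a * b - c ^+ 2) / b.
  by field.
by rewrite pmulr_lge0 ?invr_gt0 // subr_ge0.
Qed.

End PsdForm.

Lemma dot0r n (u : 'rV[R]_n) : dot u 0 = 0.
Proof. by rewrite /dot big1 // => i _; rewrite mxE mulr0. Qed.

Lemma CauchySchwarz n (u v : 'rV[R]_n) : dot u v ^+ 2 <= dot u u * dot v v.
Proof.
have := @psd_CauchySchwarz n 1%:M (trmx1 _ _) _ u v; rewrite !mulmx1; apply.
by move=> w; rewrite mulmx1 dot_ge0.
Qed.

Section Contraction.
Variables (n : nat) (T : 'M[R]_n).
Hypotheses (Tsym : T^T = T) (Tge0 : forall u, 0 <= dot (u *m T) u).
Hypothesis Tle1 : forall u, dot (u *m T) u <= dot u u.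

(** Cauchy-Schwarz for the form of T, applied to u and u T, bounds |u T|^4 by <u T, u> <u T T, u T>,
    and the last factor is at most |u T|^2 because T <= 1. *)
Lemma contraction_sqr u : dot (u *m T) (u *m T) <= dot (u *m T) u.
Proof.
have := psd_CauchySchwarz Tsym Tge0 u (u *m T).
set b := dot (u *m T) (u *m T) => H.
have := le_trans H (ler_wpM2l (Tge0 u) (Tle1 _)); rewrite -/b expr2.
have [->//|b0] := eqVneq b 0.
by rewrite ler_pM2r // lt_neqAle eq_sym b0 dot_ge0.
Qed.

Lemma trmxX k : (T ^+ k)^T = T ^+ k.
Proof.
elim: k => [|k IH]; first by rewrite expr0 trmx1.
by rewrite {1}exprSr trmx_mul IH Tsym [RHS]exprS.
Qed.

Lemma psd_pow_dbl k u : dot (u *m T ^+ (k + k)) u = dot (u *m T ^+ k) (u *m T ^+ k).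
Proof. by rewrite exprD mulmxA dot_mulmx trmxX. Qed.

(* Jensen's inequality for the powers of T, along powers of 2 *)
Lemma psd_pow_ge (th : R) u j : 0 <= th ->
  th * dot u u <= dot (u *m T) u ->
  th ^+ (2 ^ j) * dot u u <= dot (u *m T ^+ (2 ^ j)) u.
Proof.
move=> th0 H; elim: j => [|j IH]; first by rewrite expn0 !expr1.
have [u0|u0] := eqVneq (dot u u) 0.
  by rewrite (dot_eq0 u0) !mul0mx dot0r mulr0.
have up : 0 < dot u u by rewrite lt_neqAle eq_sym u0 dot_ge0.
have -> : (2 ^ j.+1 = 2 ^ j + 2 ^ j)%N by rewrite expnS mul2n addnn.
rewrite psd_pow_dbl; set v := u *m _ in IH *.
rewrite -(ler_pM2l up); apply: le_trans (CauchySchwarz u v).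
rewrite (dotC u v) exprD.
have -> : dot u u * (th ^+ (2 ^ j) * th ^+ (2 ^ j) * dot u u) =
  (th ^+ (2 ^ j) * dot u u) ^+ 2 by ring.
by rewrite lerXn2r // nnegrE ?mulr_ge0 ?exprn_ge0 ?dot_ge0 // (le_trans _ IH) ?mulr_ge0 ?exprn_ge0 ?dot_ge0.
Qed.

End Contraction.

(** The Gram formula B^T (B B^T)^-1 B for a basis B of W. It avoids the square roots of an
    orthonormal basis, so that it makes sense over any real field. *)
Lemma orthogonal_projection n m (W : 'M[R]_(m, n)) : exists P : 'M[R]_n,
  [/\ P^T = P, P *m P = P, forall u : 'rV_n, (u *m P <= W)%MS,
      forall u : 'rV_n, (u <= W)%MS -> u *m P = u & \tr P = (\rank W)%:R].
Proof.
have [B Bfree [BW WB]] : exists2 B : 'M[R]_(\rank W, n), row_free B & (B <= W)%MS /\ (W <= B)%MS.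
  by exists (row_base W); rewrite ?row_base_free // !eq_row_base.
pose M := B *m B^T.
have MU : M \in unitmx.
  rewrite -row_free_unit; apply/row_freeP/row_freeP; rewrite -kermx_eq0.
  apply/rowV0P => v /sub_kermxP vM.
  have vB : v *m B = 0.
    by apply: dot_eq0; rewrite dot_mulmx -mulmxA vM dot0r.
  have /row_freeP[B' BB'] : row_free B := Bfree.
  by rewrite -[v]mulmx1 -BB' mulmxA vB mul0mx.
have Msym : M^T = M by rewrite /M trmx_mul trmxK.
exists (B^T *m invmx M *m B); split.
- by rewrite !trmx_mul trmxK trmx_inv Msym mulmxA.
- by rewrite -!mulmxA (mulmxA B B^T) -/M mulKmx.
- by move=> u; rewrite mulmxA (submx_trans (submxMl _ _)).
- move=> u uW; have /submxP[w ->] := submx_trans uW WB.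
  by rewrite -!mulmxA (mulmxA B B^T) -/M mulKVmx.
- by rewrite mxtrace_mulC mulmxA mulmxV // mxtrace1.
Qed.

(** With P the projection onto W and P' = 1 - P, the trace splits into those of P Q P and P' Q P'.
    The former dominates th P, whose trace is th times the rank; the latter is nonnegative. *)
Lemma rank_le_trace n m (Q : 'M[R]_n) (W : 'M[R]_(m, n)) (th : R) :
  (forall u, 0 <= dot (u *m Q) u) ->
  (forall u, (u <= W)%MS -> th * dot u u <= dot (u *m Q) u) ->
  (\rank W)%:R * th <= \tr Q.
Proof.
move=> Q0 QW; have [P [Psym PP PW _ trP]] := orthogonal_projection W.
pose P' := 1%:M - P.
have P'sym : P'^T = P' by rewrite /P' linearB /= trmx1 Psym.
have P'P' : P' *m P' = P'.
  by rewrite /P' mulmxBl mul1mx mulmxBr mulmx1 PP subrr subr0.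
have -> : \tr Q = \tr (P *m Q *m P) + \tr (P' *m Q *m P').
  rewrite (mxtrace_mulC (P *m Q) P) (mxtrace_mulC (P' *m Q) P').
  rewrite (mulmxA P P) (mulmxA P' P') PP P'P' -mxtraceD -mulmxDl.
  by rewrite /P' addrC subrK mul1mx.
have -> : (\rank W)%:R * th = \tr (th *: P) by rewrite mxtraceZ trP mulrC.
rewrite -subr_ge0 addrAC -linearB addr_ge0 //; apply: mxtrace_ge0 => u.
  have -> : P *m Q *m P - th *: P = P *m (Q - th%:M) *m P.
    by rewrite mulmxBr mulmxBl mul_mx_scalar -scalemxAl PP.
  rewrite !mulmxA (dot_mulmx _ P) Psym mulmxBr mul_mx_scalar dotBl dotZl.
  by rewrite subr_ge0 QW.
by rewrite !mulmxA (dot_mulmx _ P') P'sym.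
Qed.

(** The rank is the sum of the diagonal entries P x x = |delta_x P|^2, and Cauchy-Schwarz against v
    gives P x x >= v_x^2 / |v|^2 >= c. Linear dependence among the vectors for different x thus does
    no harm. *)
Lemma rank_ge_card n m (W : 'M[R]_(m, n)) (X : {set 'I_n}) (c : R) :
  (forall x, x \in X -> exists v : 'rV_n,
    [/\ (v <= W)%MS, 0 < dot v v & c * dot v v <= v 0 x ^+ 2]) ->
  #|X|%:R * c <= (\rank W)%:R.
Proof.
move=> XW; have [P [Psym PP _ PW <-]] := orthogonal_projection W.
have PE x : P x x = dot (delta_mx 0 x *m P) (delta_mx 0 x *m P).
  by rewrite -dot_delta -{1}PP mulmxA dot_mulmx Psym.
rewrite mulr_natl -sumr_const big_mkcond; apply: ler_sum => x _; rewrite PE.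
case: ifP => [/XW[v [vW v0 vx]]|_]; last exact: dot_ge0.
have := CauchySchwarz v (delta_mx 0 x *m P).
rewrite -{1}Psym -dot_mulmx PW // /dot [X in X ^+ 2](bigD1 x) //= [X in _ + X]big1; last first.
  by move=> y yx; rewrite mxE (negPf yx) andbF mulr0.
rewrite mxE !eqxx mulr1 addr0 -/(dot v v) -/(dot _ _) => h.
by rewrite -(ler_pM2l v0) mulrC (le_trans vx h).
Qed.

End Dot.

(** * Spectral subspaces of a symmetric matrix *)

Section Eig.
Variables (R : realType) (n : nat) (A : 'M[R]_n).
Hypothesis Asym : A^T = A.

Lemma eigen_orthogonal (x y : R) u v : u *m A = x *: u -> v *m A = y *: v ->
  x != y -> dot u v = 0.
Proof.
move=> ux vy xy; have := dot_mulmx u A v.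
rewrite Asym ux vy dotZl dotZr => /eqP.
by rewrite -subr_eq0 -mulrBl mulf_eq0 subr_eq0 (negPf xy) => /eqP.
Qed.

(** W is the direct sum of the eigenspaces for eigenvalues in B. The clause on K transfers to all of
    W what every such eigenvector satisfies, such as vanishing at a vertex; the last clause rests on
    the orthogonality of the eigenspaces. *)
Lemma eig_count_space (B : set R) : exists W : 'M[R]_n,
  [/\ \rank W = eig_count A B,
   forall m (K : 'M[R]_(n, m)), (forall x (v : 'rV_n), B x -> v *m A = x *: v -> v *m K = 0) ->
     W *m K = 0 &
   forall (E : R) v, (forall x, B x -> x <= E) -> (v <= W)%MS ->
     dot (v *m A) v <= E * dot v v].
Proof.
pose s := [seq x <- fset_set [set x | eigenvalue A x] | x \in B].
have us : uniq s by rewrite filter_uniq // fset_uniq.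
have sB x : x \in s -> B x by rewrite mem_filter => /andP[/set_mem].
pose W := (\sum_(i < (size s)) eigenspace A (nth 0 s i))%MS.
have sin (i : 'I_(size s)) : (nth 0 s i) \in s by exact: mem_nth.
have inj (i j : 'I_(size s)) : (nth 0 s i) = (nth 0 s j) -> i = j.
  by move=> /eqP; rewrite nth_uniq // => /eqP/val_inj.
exists W; split.
- have /mxdirectP : mxdirect W by apply: mxdirect_sum_eigenspace => i j _ _ /inj.
  rewrite /= => ->; rewrite /eig_count fsbig_mkcond.
  rewrite (fsbigTE (fset_set [set x | eigenvalue A x])); last first.
    move=> x; rewrite (in_fset_set (fin_eigenvalues A)) notin_setE /= /patch => /negP.
    by rewrite negbK => /eqP ->; rewrite mxrank0 if_same.
  rewrite -(big_mkord xpredT (fun i => \rank (eigenspace A (nth 0 s i)))).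
  by rewrite -(big_nth 0 xpredT (fun x => \rank (eigenspace A x))) big_filter big_mkcond.
- move=> m K HK; apply/eqP; rewrite -sub_kermx; apply/sumsmx_subP => i _.
  apply/rV_subP => v /eigenspaceP Hv; apply/sub_kermxP.
  by apply: HK Hv; exact: sB.
- move=> E v BE /sub_sumsmxP[u ->].
  set w := fun i => u i *m eigenspace A (nth 0 s i).
  have wA i : w i *m A = (nth 0 s i) *: w i.
    by apply/eigenspaceP; exact: submxMl.
  have orth i j : i != j -> dot (w i) (w j) = 0.
    by move=> ij; apply: eigen_orthogonal (wA i) (wA j) _; apply: contra ij => /eqP/inj ->.
  rewrite -/w mulmx_suml !dot_suml mulr_sumr; apply: ler_sum => i _.
  rewrite wA dotZl dot_sumr (bigD1 i) //= big1 ?addr0 => [|j ji]; last first.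
    by rewrite orth // eq_sym.
  by rewrite ler_wpM2r ?dot_ge0 // BE //; exact: sB.
Qed.

End Eig.

(** * Isoperimetry and the Laplacian of a graph *)

Section Graph.
Variables (N : nat) (G : {set {set 'I_N}}).
Implicit Types (A B : {set 'I_N}) (i j : 'I_N).

Definition adj i j : bool := [set i; j]%SET \in G.

Lemma adjC i j : adj i j = adj j i.
Proof. by rewrite /adj finset.setUC. Qed.

Definition edge_cut A : nat := (\sum_(i in A) \sum_(j in ~: A) adj i j)%N.

(** Connectedness through cuts instead of paths: its failure hands over a part of A without edges to
    the rest, and volumes and boundaries add up along such a splitting. *)
Definition conn A : bool := (A != finset.set0) &&
  [forall B : {set 'I_N}, (B \proper A) && (B != finset.set0) ==>
    [exists i in B, [exists j in A :\: B, adj i j]]].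

Lemma connP A B : conn A -> B \proper A -> B != finset.set0 ->
  exists i j, [/\ i \in B, j \in A, j \notin B & adj i j].
Proof.
case/andP => _ /forallP/(_ B) H BA B0; move: H; rewrite BA B0 /=.
move=> /exists_inP[i iB /exists_inP[j]]; rewrite inE => /andP[jB jA] ij.
by exists i, j.
Qed.

Lemma degreeE i : degree G i = (\sum_j adj i j)%N.
Proof.
rewrite /degree -sum1_card big_mkcond /=; apply: eq_bigr => j _.
by rewrite inE -/(adj i j); case: (adj i j).
Qed.

Lemma sum_degree A :
  (\sum_(i in A) degree G i = \sum_(i in A) \sum_(j in A) adj i j + edge_cut A)%N.
Proof.
rewrite /edge_cut -big_split; apply: eq_bigr => i _ /=.
rewrite degreeE (bigID (mem A)) /=; congr addn.
by apply: eq_bigl => j; rewrite inE.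
Qed.

Lemma sum_setD A B (F : 'I_N -> nat) : B \subset A ->
  (\sum_(i in A) F i = \sum_(i in B) F i + \sum_(i in A :\: B) F i)%N.
Proof.
move=> BA; rewrite (bigID (mem B)) /=; congr addn; apply: eq_bigl => i.
  by rewrite andbC; case iB: (i \in B) => //=; rewrite (fintype.subsetP BA).
by rewrite inE andbC.
Qed.

Lemma cut_split A B : B \subset A ->
  (forall i j, i \in B -> j \in A :\: B -> ~~ adj i j) ->
  edge_cut A = (edge_cut B + edge_cut (A :\: B))%N.
Proof.
move=> BA noE; rewrite /edge_cut (sum_setD _ BA); congr addn; apply: eq_bigr => i iB.
  rewrite [RHS](bigID (mem A)) /= [X in _ = (X + _)%N]big1 ?add0n.
    apply: eq_bigl => j; rewrite !inE; case jA: (j \in A); rewrite ?andbF ?andbT //=.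
    by apply/esym/negP => /(fintype.subsetP BA); rewrite jA.
  move=> j; rewrite inE => /andP[jB jA]; apply/eqP; rewrite eqb0.
  by apply: noE => //; rewrite inE jB.
rewrite [RHS](bigID (mem A)) /= [X in _ = (X + _)%N]big1 ?add0n.
  apply: eq_bigl => j; rewrite !inE; case jA: (j \in A); rewrite ?andbF ?andbT //=.
move=> j; rewrite !inE => /andP[jB jA]; apply/eqP; rewrite eqb0 adjC.
by apply: noE => //; move: jB; rewrite jA andbT negbK.
Qed.

(** Both sides add up over a splitting of A into two parts without edges between them, so induction
    on the cardinality reduces to connected sets. *)
Lemma isoperimetric_of_conn (U : {set 'I_N}) (w : 'I_N -> nat) M K :
  (forall A, conn A -> A \subset U -> (#|A| <= M)%N ->
     (\sum_(i in A) w i <= K * edge_cut A)%N) ->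
  forall A, A \subset U -> (#|A| <= M)%N -> (\sum_(i in A) w i <= K * edge_cut A)%N.
Proof.
move=> H A; have [m] := ubnP #|A|; elim: m A => // m IH A Am AU AM.
have [cA|] := boolP (conn A); first exact: H.
rewrite negb_and negbK => /orP[/eqP ->|]; first by rewrite big_set0.
move=> /forallPn[B]; rewrite negb_imply => /andP[/andP[BA B0] noE].
have BsA := fintype.proper_sub BA.
have noE' i j : i \in B -> j \in A :\: B -> ~~ adj i j.
  move=> iB jAB; apply: contra noE => ij.
  by apply/exists_inP; exists i => //; apply/exists_inP; exists j.
rewrite (cut_split BsA noE') mulnDr (sum_setD _ BsA).
have cB : (#|B| < #|A|)%N by exact: proper_card.
have cAB : (#|A :\: B| < #|A|)%N.
  by rewrite cardsDS // ltn_subrL card_gt0 B0 (leq_ltn_trans _ cB).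
rewrite leq_add // IH ?(leq_trans _ AM) ?(ltnW cB) ?(ltnW cAB) //.
- by rewrite (leq_trans cB).
- exact: fintype.subset_trans BsA AU.
- by rewrite (leq_trans cAB).
- by rewrite (fintype.subset_trans _ AU) // subsetDl.
Qed.

Variable R : realType.

Lemma sum_adj_l (F : 'I_N -> R) :
  \sum_i \sum_j (adj i j)%:R * F i = \sum_i (degree G i)%:R * F i.
Proof. by apply: eq_bigr => i _; rewrite -mulr_suml degreeE natr_sum. Qed.

Lemma sum_adj_r (F : 'I_N -> R) :
  \sum_i \sum_j (adj i j)%:R * F j = \sum_i (degree G i)%:R * F i.
Proof.
rewrite exchange_big -sum_adj_l; apply: eq_bigr => i _; apply: eq_bigr => j _.
by rewrite adjC.
Qed.

Lemma sum_adj_tent A :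
  \sum_i \sum_j (adj i j)%:R * `|(i \in A)%:R - (j \in A)%:R| = 2 * (edge_cut A)%:R :> R.
Proof.
pose F (X Y : {set 'I_N}) : R := \sum_(i in X) \sum_(j in Y) (adj i j)%:R.
have FE X Y : F X Y = (\sum_(i in X) \sum_(j in Y) adj i j)%:R.
  by rewrite natr_sum; apply: eq_bigr => i _; rewrite natr_sum.
have FC X Y : F X Y = F Y X.
  by rewrite /F exchange_big; apply: eq_bigr => i _; apply: eq_bigr => j _; rewrite adjC.
have -> : 2 * (edge_cut A)%:R = F A (~: A) + F (~: A) A.
  by rewrite (FC (~: A)) FE -/(edge_cut A) mulr_natl mulr2n.
rewrite (bigID (mem A)) /=; congr (_ + _).
  apply: eq_bigr => i iA; rewrite [RHS]big_mkcond; apply: eq_bigr => j _.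
  by rewrite inE iA; case: (j \in A); rewrite /= ?subrr ?normr0 ?mulr0 // subr0 normr1 mulr1.
rewrite /F [RHS](eq_bigl (fun i => i \notin A)); last by move=> i; rewrite inE.
apply: eq_bigr => i iA; rewrite [RHS]big_mkcond; apply: eq_bigr => j _.
rewrite (negPf iA); case: (j \in A); rewrite /= ?subrr ?normr0 ?mulr0 //.
by rewrite sub0r normrN normr1 mulr1.
Qed.

(* Coarea formula, by peeling off the level sets of g from the bottom. *)
Lemma coarea_ge (h : R) (w g : 'I_N -> R) : (forall i, 0 <= g i) ->
  (forall A, A \subset [set i | g i != 0]%SET ->
     h * \sum_(i in A) w i <= (edge_cut A)%:R) ->
  2 * h * \sum_i w i * g i <= \sum_i \sum_j (adj i j)%:R * `|g i - g j|.
Proof.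
have [m] := ubnP #|[set i | g i != 0]%SET|; elim: m g => // m IH g Am g0 H.
set A := [set i | _]%SET in Am H.
have [A0|[i0 i0A]] := set_0Vmem A.
  rewrite big1 ?mulr0; last first.
    move=> i _; have : i \notin A by rewrite A0 inE.
    by rewrite inE negbK => /eqP ->; rewrite mulr0.
  by apply: sumr_ge0 => i _; apply: sumr_ge0 => j _; rewrite mulr_ge0.
case: (arg_minP g i0A) => k kA kmin; set t := g k in kmin.
pose g' i := g i - t * (i \in A)%:R.
have g'A i : i \in A -> g' i = g i - t by move=> iA; rewrite /g' iA mulr1.
have gnA i : i \notin A -> g i = 0 by rewrite inE negbK => /eqP.
have g'nA i : i \notin A -> g' i = 0.
  by move=> iA; rewrite /g' gnA // (negPf iA) mulr0 subr0.
have g'0 i : 0 <= g' i.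
  have [iA|iA] := boolP (i \in A); first by rewrite g'A // subr_ge0 kmin.
  by rewrite g'nA.
have sub : [set i | g' i != 0]%SET \subset A.
  by apply/fintype.subsetP => i; rewrite inE; apply: contraNT => /g'nA ->.
have := IH g' _ g'0 _.
have -> : \sum_i w i * g' i = \sum_i w i * g i - t * \sum_(i in A) w i.
  rewrite [X in t * X]big_mkcond mulr_sumr -sumrB; apply: eq_bigr => i _.
  by rewrite /g'; case: (i \in A) => /=; ring.
have -> : \sum_i \sum_j (adj i j)%:R * `|g i - g j| =
    \sum_i \sum_j (adj i j)%:R * `|g' i - g' j| + t * (2 * (edge_cut A)%:R).
  rewrite -sum_adj_tent mulr_sumr -big_split; apply: eq_bigr => i _.
  rewrite mulr_sumr -big_split; apply: eq_bigr => j _ /=.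
  rewrite mulrCA -mulrDr; congr (_ * _).
  have [iA|iA] := boolP (i \in A); have [jA|jA] := boolP (j \in A).
  - by rewrite !g'A // subrr normr0 mulr0 addr0; congr `|_|; ring.
  - rewrite (g'A i) // (g'nA j) // (gnA j) // !subr0 normr1 mulr1.
    by rewrite !ger0_norm ?subr_ge0 ?kmin // subrK.
  - rewrite (g'A j) // (g'nA i) // (gnA i) // !sub0r !normrN normr1 mulr1.
    by rewrite !ger0_norm ?subr_ge0 ?kmin // subrK.
  - by rewrite !g'nA // !gnA // !subr0 normr0 mulr0 addr0.
have tc : t * (h * \sum_(i in A) w i) <= t * (edge_cut A)%:R.
  by apply: ler_wpM2l; [exact: g0|exact: H].
have cA' : (#|[set i | (g' i != 0)%R]%SET| < m)%N.
  rewrite -ltnS; apply: leq_trans Am; rewrite ltnS; apply: proper_card.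
  apply/properP; split=> //; exists k => //.
  by rewrite inE g'A // subrr eqxx.
move=> IHg; have := IHg cA' (fun B BA => H B (fintype.subset_trans BA sub)); lra.
Qed.

(* [|f_i^2 - f_j^2| <= (f_i - f_j)^2 / (2 t) + t (f_i + f_j)^2 / 2] with [t = h / 2] *)
Lemma cheeger (h : R) (f : 'I_N -> R) : 0 < h ->
  (forall A, A \subset [set i | f i != 0]%SET ->
     h * \sum_(i in A) ((degree G i).+1)%:R <= (edge_cut A)%:R) ->
  h ^+ 2 * \sum_i f i ^+ 2 <= \sum_i \sum_j (adj i j)%:R * (f i - f j) ^+ 2.
Proof.
move=> h0 H.
have := @coarea_ge h (fun i => ((degree G i).+1)%:R) (fun i => f i ^+ 2) _ _.
have f0 i : 0 <= f i ^+ 2 by rewrite sqr_ge0.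
have H' A : A \subset [set i | f i ^+ 2 != 0]%SET ->
     h * \sum_(i in A) ((degree G i).+1)%:R <= (edge_cut A)%:R.
  move=> As; apply: H; apply: fintype.subset_trans As _.
  by apply/fintype.subsetP => i; rewrite !inE sqrf_eq0.
move=> /(_ f0 H').
set Q := (X in _ -> _ <= X); set X := \sum_i _ * _.
set Y := \sum_i \sum_j _ => XY.
have degf := sum_adj_l (fun i => f i ^+ 2); have degf' := sum_adj_r (fun i => f i ^+ 2).
have XE : X = \sum_i (degree G i)%:R * f i ^+ 2 + \sum_i f i ^+ 2.
  by rewrite -big_split; apply: eq_bigr => i _; rewrite -addn1 natrD mulrDl mul1r.
have YQ : Y <= h^-1 * Q + h * \sum_i (degree G i)%:R * f i ^+ 2.
  have -> : \sum_i (degree G i)%:R * f i ^+ 2 =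
    2^-1 * (\sum_i \sum_j (adj i j)%:R * f i ^+ 2 + \sum_i \sum_j (adj i j)%:R * f j ^+ 2).
    by rewrite degf degf'; lra.
  rewrite -big_split /= !mulr_sumr -big_split; apply: ler_sum => i _ /=.
  rewrite -big_split /= !mulr_sumr -big_split; apply: ler_sum => j _ /=.
  rewrite -mulrDr !(mulrCA _ (adj i j)%:R) -mulrDr ler_wpM2l //.
  rewrite subr_sqr normrM.
  have := sqr_ge0 (`|f i - f j| - h / 2 * `|f i + f j|).
  rewrite sqrrB [_ ^+ 2 in X in _ + X]exprMn !real_normK ?num_real // => sq.
  rewrite -(ler_pM2l h0) mulrDr mulVKf ?gt_eqF //.
  have := sqr_ge0 (h * f i - h * f j); lra.
have E0 : 0 <= \sum_i f i ^+ 2 by apply: sumr_ge0.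
have D0 : 0 <= \sum_i (degree G i)%:R * f i ^+ 2.
  by apply: sumr_ge0 => i _; rewrite mulr_ge0.
(* With D and F the sums of deg f^2 and f^2, the bounds so far read 2 h (D + F) <= Q / h + h D. The
   weight degree + 1 is what leaves h F <= Q / h. *)
rewrite -(ler_pM2l (_ : 0 < h^-1)) ?invr_gt0 // expr2 -mulrA mulKf ?gt_eqF //.
by rewrite XE in XY; nra.
Qed.

End Graph.

(** * Inner edges and boundary edges of a vertex set *)

Section Edges.
Variables (N : nat) (G : {set {set 'I_N}}).
Hypothesis GE : G \subset edges N.
Implicit Types (A B : {set 'I_N}) (i j : 'I_N).

(** These two sets of potential edges are fixed before G is drawn and are disjoint, so that the
    edges of G in one are independent of those in the other. *)
Definition inner_edges A : {set {set 'I_N}} := [set e in edges N | e \subset A]%SET.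
Definition cut_edges A : {set {set 'I_N}} := [set e in edges N | #|e :&: A| == 1%N]%SET.

Lemma eq_set2 i j x y : x != y ->
  ([set i; j] == [set x; y])%SET = (i == x) && (j == y) || (i == y) && (j == x).
Proof.
move=> xy; apply/eqP/idP => [E|]; last first.
  by case/orP => /andP[/eqP -> /eqP ->] //; rewrite finset.setUC.
have : x \in [set i; j]%SET by rewrite E set21.
have : y \in [set i; j]%SET by rewrite E set22.
rewrite !inE => /orP[/eqP yi|/eqP yj] /orP[/eqP xi|/eqP xj].
- by move: xy; rewrite xi yi eqxx.
- by rewrite yi xj !eqxx orbT.
- by rewrite xi yj !eqxx.
- by move: xy; rewrite xj yj eqxx.
Qed.

Lemma sum_indic (T : finType) (A : {set T}) (x : T) : (\sum_(i in A) (i == x) = (x \in A))%N.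
Proof.
rewrite big_mkcond (bigD1 x) //= big1 ?addn0 => [|i /negPf ->]; last by case: ifP.
by rewrite eqxx; case: (x \in A).
Qed.

Lemma sum_adj_edges A B :
  (\sum_(i in A) \sum_(j in B) adj G i j =
   \sum_(e in G) \sum_(i in A) \sum_(j in B) ([set i; j] == e)%SET)%N.
Proof.
rewrite [RHS]exchange_big; apply: eq_bigr => i _.
rewrite [RHS]exchange_big; apply: eq_bigr => j _ /=.
by rewrite -sum_indic; apply: eq_bigr => e _; rewrite eq_sym.
Qed.

Lemma sum_edge_pairs A B x y : x != y ->
  (\sum_(i in A) \sum_(j in B) ([set i; j] == [set x; y])%SET =
    (x \in A) * (y \in B) + (y \in A) * (x \in B))%N.
Proof.
move=> xy; rewrite -!sum_indic !big_distrl -big_split; apply: eq_bigr => i _ /=.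
rewrite !big_distrr -big_split; apply: eq_bigr => j _ /=.
rewrite eq_set2 //; case: eqP => [->|_] /=; last by rewrite mul0n add0n mulnb.
by rewrite (negPf xy) orbF mul0n addn0 mul1n.
Qed.

Lemma edgeP e : e \in edges N -> exists x y, x != y /\ e = [set x; y]%SET.
Proof. by rewrite inE => /cards2P[x [y [xy ->]]]; exists x, y. Qed.

Lemma cut_edgesE A : edge_cut G A = #|G :&: cut_edges A|.
Proof.
rewrite /edge_cut sum_adj_edges -sum1_card big_mkcond [RHS]big_mkcond.
apply: eq_bigr => e _; rewrite finset.in_setI.
case eG: (e \in G) => //=; have eE := fintype.subsetP GE _ eG; rewrite inE eE /=.
have [x [y [xy ->]]] := edgeP eE; rewrite sum_edge_pairs // !inE.
have -> : #|[set x; y] :&: A|%SET = ((x \in A) + (y \in A))%N.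
  rewrite -sum1_card -(sum_indic A x) -(sum_indic A y) -big_split /=.
  rewrite big_mkcond [RHS]big_mkcond; apply: eq_bigr => i _; rewrite !inE andbC.
  by case: (i \in A) => //=; case: eqP => [->|_] /=; [rewrite (negPf xy)|case: eqP].
by case: (x \in A); case: (y \in A).
Qed.

Lemma inner_edgesE A :
  (\sum_(i in A) \sum_(j in A) adj G i j = 2 * #|G :&: inner_edges A|)%N.
Proof.
rewrite sum_adj_edges -sum1_card big_distrr big_mkcond [RHS]big_mkcond.
apply: eq_bigr => e _; rewrite finset.in_setI.
case eG: (e \in G) => //=; have eE := fintype.subsetP GE _ eG; rewrite inE eE /=.
have [x [y [xy ->]]] := edgeP eE; rewrite sum_edge_pairs // finset.subUset !finset.sub1set.
by case: (x \in A); case: (y \in A).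
Qed.

Lemma sum_degreeS A : (\sum_(i in A) (degree G i).+1 =
  2 * #|G :&: inner_edges A| + edge_cut G A + #|A|)%N.
Proof.
rewrite -(eq_bigr _ (fun i _ => addn1 (degree G i))) big_split /= sum1_card.
by rewrite sum_degree inner_edgesE.
Qed.

End Edges.

(** * The quadratic form of the Laplacian and its restriction to vertex sets *)

Section Laplacian.
Variables (R : realType) (N : nat) (G : {set {set 'I_N}}).

Lemma laplacian_sym : (laplacian R G)^T = laplacian R G.
Proof.
rewrite /laplacian linearB /= tr_diag_mx; congr (_ - _).
by apply/matrixP => i j; rewrite !mxE finset.setUC.
Qed.

Lemma dot_laplacian (f : 'rV[R]_N) : dot (f *m laplacian R G) f =
  2^-1 * \sum_i \sum_j (adj G i j)%:R * (f 0 i - f 0 j) ^+ 2.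
Proof.
have E1 := sum_adj_l G (fun i => f 0 i ^+ 2); have E2 := sum_adj_r G (fun i => f 0 i ^+ 2).
have -> : \sum_i \sum_j (adj G i j)%:R * (f 0 i - f 0 j) ^+ 2 =
   2 * (\sum_i (degree G i)%:R * f 0 i ^+ 2 - \sum_i \sum_j (adj G i j)%:R * (f 0 i * f 0 j)).
  transitivity (\sum_i \sum_j (adj G i j)%:R * f 0 i ^+ 2 + \sum_i \sum_j (adj G i j)%:R * f 0 j ^+ 2
     - 2 * \sum_i \sum_j (adj G i j)%:R * (f 0 i * f 0 j)); last by rewrite E1 E2; ring.
  rewrite mulr_sumr -big_split -sumrB; apply: eq_bigr => i _.
  rewrite mulr_sumr -big_split -sumrB; apply: eq_bigr => j _ /=; ring.
rewrite mulKf // /laplacian mulmxBr dotBl; congr (_ - _).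
  by apply: eq_bigr => i _; rewrite mul_mx_diag !mxE; ring.
rewrite exchange_big; apply: eq_bigr => j _; rewrite mxE mulr_suml.
by apply: eq_bigr => i _; rewrite mxE -/(adj G i j); ring.
Qed.

End Laplacian.

Lemma lap_entry (R : realType) N (G : {set {set 'I_N}}) (w : 'rV[R]_N) x :
  (w *m laplacian R G) 0 x = \sum_y (adj G x y)%:R * (w 0 x - w 0 y).
Proof.
rewrite /laplacian mulmxBr mul_mx_diag !mxE degreeE natr_sum mulr_sumr -sumrB.
apply: eq_bigr => y _; rewrite mxE -/(adj G y x) adjC; ring.
Qed.

Section Restriction.
Variables (R : realType) (N : nat) (G : {set {set 'I_N}}).
Local Notation lap := (laplacian R G).
Implicit Types (A B : {set 'I_N}) (f u v : 'rV[R]_N).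

Definition restrict_mx A : 'M[R]_N := diag_mx (\row_i (i \in A)%:R).

Lemma restrict_mxE u A i : (u *m restrict_mx A) 0 i = if i \in A then u 0 i else 0.
Proof. by rewrite mul_mx_diag !mxE; case: ifP => _; rewrite ?mulr1 ?mulr0. Qed.

Lemma dot_restrict_le u A : dot (u *m restrict_mx A) (u *m restrict_mx A) <= dot u u.
Proof.
apply: ler_sum => i _; rewrite restrict_mxE.
by case: ifP => // _; rewrite mul0r -expr2 sqr_ge0.
Qed.

Lemma lap_ge0 f : 0 <= dot (f *m lap) f.
Proof.
rewrite dot_laplacian // mulr_ge0 ?invr_ge0 //.
by apply: sumr_ge0 => i _; apply: sumr_ge0 => j _; rewrite mulr_ge0 ?sqr_ge0.
Qed.

(** By (f_i - f_j)^2 <= 2 f_i^2 + 2 f_j^2. Only the degrees on the support of f count, so vertices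
    of large degree are harmless once they are removed. *)
Lemma lap_le (d : nat) f :
  (forall i, f 0 i != 0 -> (degree G i <= d)%N) ->
  dot (f *m lap) f <= (2 * d)%:R * dot f f.
Proof.
move=> deg; rewrite dot_laplacian //.
have E1 := sum_adj_l G (fun i => f 0 i ^+ 2); have E2 := sum_adj_r G (fun i => f 0 i ^+ 2).
have : \sum_i \sum_j (adj G i j)%:R * (f 0 i - f 0 j) ^+ 2 <=
  2 * (\sum_i \sum_j (adj G i j)%:R * f 0 i ^+ 2 + \sum_i \sum_j (adj G i j)%:R * f 0 j ^+ 2).
  rewrite -big_split mulr_sumr; apply: ler_sum => i _ /=.
  rewrite -big_split mulr_sumr; apply: ler_sum => j _ /=.
  rewrite -mulrDr [leRHS]mulrCA ler_wpM2l //.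
  have := sqr_ge0 (f 0 i + f 0 j); nra.
rewrite E1 E2 => H.
have : \sum_i (degree G i)%:R * f 0 i ^+ 2 <= d%:R * dot f f.
  rewrite mulr_sumr; apply: ler_sum => i _; rewrite -expr2.
  have [->|fi] := eqVneq (f 0 i) 0; first by rewrite expr0n !mulr0.
  by rewrite ler_wpM2r ?sqr_ge0 // ler_nat deg.
rewrite natrM; lra.
Qed.

(** Cheeger's inequality with h = 1/K; the factor 2 comes from the sum over ordered pairs. Only sets
    inside the support are tested, which makes the bound a local one. *)
Lemma lap_gap (K : nat) f : (0 < K)%N ->
  (forall A, A \subset [set i | f 0 i != 0]%SET ->
     (\sum_(i in A) (degree G i).+1 <= K * edge_cut G A)%N) ->
  dot f f <= 2 * K%:R ^+ 2 * dot (f *m lap) f.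
Proof.
move=> K0 H; have K0' : 0 < K%:R :> R by rewrite ltr0n.
have H' A : A \subset [set i | f 0 i != 0]%SET ->
    K%:R^-1 * \sum_(i in A) ((degree G i).+1)%:R <= (edge_cut G A)%:R :> R.
  by move=> /H; rewrite ler_pdivrMl // -natr_sum -natrM ler_nat.
have := @cheeger _ G R K%:R^-1 (fun i => f 0 i); rewrite invr_gt0 => /(_ K0' H').
rewrite exprVn ler_pdivrMl ?exprn_gt0 // => cheeger.
by rewrite dot_laplacian // [2 * _]mulrC -mulrA mulVKf.
Qed.

Lemma lap_const : const_mx 1 *m lap = 0 :> 'rV[R]_N.
Proof.
apply/rowP => j; rewrite /laplacian mulmxBr mul_mx_diag !mxE degreeE natr_sum mul1r.
apply/eqP; rewrite subr_eq0; apply/eqP; apply: eq_bigr => i _.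
by rewrite !mxE mul1r -/(adj G i j) adjC.
Qed.

(** Without boundary edges the Laplacian is block diagonal with respect to A and its complement. *)
Lemma restrict_component A (v : 'rV[R]_N) x : edge_cut G A = 0%N ->
  v *m lap = x *: v -> v *m restrict_mx A *m lap = x *: (v *m restrict_mx A).
Proof.
move=> /eqP; rewrite sum_nat_eq0 => /forall_inP cA vx.
have noE i j : i \in A -> j \notin A -> adj G i j = false.
  move=> iA jA; have := cA i iA; rewrite sum_nat_eq0 => /forall_inP/(_ j).
  by rewrite inE jA eqb0 => /(_ isT)/negPf.
have lap0 i j : (i \in A) != (j \in A) -> lap i j = 0.
  move=> ij; have nij : i != j by apply: contraNneq ij => ->.
  rewrite !mxE (negPf nij) mulr0n sub0r -/(adj G i j).
  move: ij; have [iA|iA] := boolP (i \in A); have [jA|jA] := boolP (j \in A) => //.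
    by rewrite noE // oppr0.
  by rewrite adjC noE // oppr0.
apply/rowP => j; rewrite mxE [RHS]mxE restrict_mxE.
have [jA|jA] := boolP (j \in A); last first.
  rewrite mulr0 big1 // => i _; rewrite restrict_mxE; case: ifP => iA; rewrite ?mul0r //.
  by rewrite lap0 ?mulr0 // iA (negPf jA).
have := congr1 (fun w : 'rV_N => w 0 j) vx; rewrite mxE [RHS]mxE => <-.
apply: eq_bigr => i _; rewrite restrict_mxE; case: ifP => // iA.
by rewrite lap0 ?mulr0 // iA jA.
Qed.

(* The eigenfunction has mean zero on the component A, so subtracting from it its value at a
   point of A increases its norm and makes its support a proper subset of A. *)
Lemma eigenvector_small_component A (K : nat) (v : 'rV[R]_N) x :
  (0 < K)%N -> A != finset.set0 -> edge_cut G A = 0%N ->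
  (forall B, B \proper A -> (\sum_(i in B) (degree G i).+1 <= K * edge_cut G B)%N) ->
  0 < x -> 2 * K%:R ^+ 2 * x < 1 ->
  v *m lap = x *: v -> forall i, i \in A -> v 0 i = 0.
Proof.
move=> K0 /finset.set0Pn[k kA] cA iso x0 Kx vx i iA.
set f := v *m restrict_mx A; have fx : f *m lap = x *: f by exact: restrict_component.
have f1 : dot f (const_mx 1) = 0.
  have := dot_mulmx f lap (const_mx 1).
  rewrite laplacian_sym // lap_const fx dotZl dot0r => /eqP.
  by rewrite mulf_eq0 gt_eqF //= => /eqP.
pose c := f 0 k; pose a : 'rV[R]_N := const_mx 1 *m restrict_mx A.
have aE j : a 0 j = (j \in A)%:R by rewrite restrict_mxE mxE; case: ifP.
have fE j : f 0 j = if j \in A then v 0 j else 0 by exact: restrict_mxE.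
have fa : dot f a = 0.
  rewrite -f1; apply: eq_bigr => j _; rewrite aE fE mxE.
  by case: ifP; rewrite ?mul0r.
pose g := f - c *: a.
have gE j : g 0 j = f 0 j - c * (j \in A)%:R by rewrite [LHS]mxE [X in _ + X]mxE [X in - X]mxE aE.
have lapa : a *m lap = 0.
  by rewrite /a (@restrict_component A _ 0) ?scale0r // lap_const.
have gg : dot (g *m lap) g = x * dot f f.
  rewrite /g mulmxBl -scalemxAl lapa scaler0 subr0 fx dotZl -scaleNr.
  by rewrite dotDr dotZr fa mulr0 addr0.
have ff : dot f f <= dot g g.
  have -> : dot g g = dot f f + c ^+ 2 * dot a a.
    rewrite /g -scaleNr !(dotDl, dotDr, dotZl, dotZr) (dotC a f) fa; ring.
  by rewrite lerDl mulr_ge0 ?sqr_ge0 ?dot_ge0.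
have /lap_gap : forall B, B \subset [set j | g 0 j != 0]%SET ->
     (\sum_(j in B) (degree G j).+1 <= K * edge_cut G B)%N.
  move=> B Bg; apply: iso; apply/properP; split; last first.
    exists k => //; apply: contraTN (kA) => /(fintype.subsetP Bg).
    by rewrite inE gE kA mulr1 subrr eqxx.
  apply: fintype.subset_trans Bg _; apply/fintype.subsetP => j; rewrite inE.
  apply: contraNT => /negPf jA; by rewrite gE fE jA mulr0 subrr.
move=> /(_ K0); rewrite gg => H.
have : dot f f = 0 by have := dot_ge0 f; nra.
by move=> /dot_eq0/rowP/(_ i); rewrite fE iA mxE.
Qed.

End Restriction.

(** * Counting small eigenvalues of a fixed graph *)

(** Here n, c and b stand for the inner edges, the boundary edges and the vertices of a set, so that
    [2 * n + c + b] is its sum of degree + 1. A set of small inner volume needs just one boundary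
    edge. *)
Lemma linear_cut_bound L n c b : (0 < c)%N -> (2 * n + b <= 3 * L)%N ->
  (2 * n + c + b <= (3 * L + 1) * c)%N.
Proof.
move=> c0 nb; have : (3 * L <= 3 * L * c)%N by rewrite leq_pmulr.
lia.
Qed.

Lemma sqr_ge16 (R : realType) (k : R) : 4 <= k -> 16 <= k ^+ 2.
Proof. by move=> k4; rewrite expr2; nra. Qed.

Lemma card_bigcup_le (I T : finType) (P : {set I}) (F : I -> {set T}) :
  (#|\big[@finset.setU _/finset.set0]_(i in P) F i| <= \sum_(i in P) #|F i|)%N.
Proof.
elim/big_rec2: _ => [|i n X _ h]; first by rewrite cards0.
by rewrite (leq_trans (leq_card_setU _ _)) // leq_add2l.
Qed.

Section Count.
Variables (R : realType) (N : nat) (G : {set {set 'I_N}}).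
Hypothesis GE : G \subset edges N.
Local Notation lap := (laplacian R G).
Variables (L D M j : nat) (eps E : R) (S : {set 'I_N}).
Hypotheses (L0 : (0 < L)%N) (LM : (L <= M)%N) (D0 : (0 < D)%N)
  (DM : (D.+1 ^ (2 ^ j) <= M)%N).
Hypotheses (epsL : 1 <= eps * L%:R) (E0 : 0 < E)
  (EL : 8 * (3 * L + 1)%:R ^+ 2 * E <= 1).
Hypothesis S_cycle : forall A, conn G A -> (#|A| <= M)%N ->
  (#|A| <= #|G :&: inner_edges A|)%N -> A \subset S.
Hypothesis S_cut : forall A, conn G A -> (L <= #|A| <= M)%N ->
  (#|G :&: inner_edges A| < #|A|)%N -> (edge_cut G A)%:R <= eps * #|A|%:R ->
  A \subset S.
Hypothesis S_degree : forall i, i \notin S -> (degree G i <= D)%N.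

(** Small components have no boundary and would violate the isoperimetric bound, so their vertices
    are kept out of U. This costs nothing: eigenvectors with eigenvalue in (0, E) vanish at those
    outside S. *)
Definition small_vertices : {set 'I_N} :=
  [set i | [exists A : {set 'I_N}, [&& i \in A, conn G A, (#|A| < L)%N & edge_cut G A == 0%N]]]%SET.

Local Notation U := (~: (S :|: small_vertices))%SET.
Local Notation K := (3 * L + 1)%N.
Local Notation C := ((2 * D)%:R : R).

(** A may be taken connected; since it avoids S, it has fewer inner edges than vertices. With fewer
    than L vertices it has a boundary edge, not being a small component; otherwise its boundary
    exceeds eps |A| >= |A| / L. *)
Lemma isoperimetric (A : {set 'I_N}) : A \subset U -> (#|A| <= M)%N ->
  (\sum_(i in A) (degree G i).+1 <= K * edge_cut G A)%N.
Proof.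
apply: (isoperimetric_of_conn (M := M)) => {}A cA AU AM.
have /andP[/finset.set0Pn[x xA] _] := cA.
have := fintype.subsetP AU _ xA; rewrite !inE negb_or => /andP[xS xSm].
have inn : (#|G :&: inner_edges A| < #|A|)%N.
  rewrite ltnNge; apply/negP => H; have := S_cycle cA AM H.
  by move=> /fintype.subsetP/(_ _ xA); rewrite (negPf xS).
rewrite sum_degreeS //.
have [AL|AL] := ltnP #|A| L.
  have : (0 < edge_cut G A)%N.
    rewrite lt0n; apply: contra xSm => cA0; apply/existsP; exists A.
    by rewrite xA cA AL cA0.
  by move=> c0; apply: (linear_cut_bound c0); move: inn AL; clear; lia.
suff : (#|A| <= L * edge_cut G A)%N.
  by move: (edge_cut G A) (#|A|) (#|G :&: _|) inn => c a e; clear; lia.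
rewrite leqNgt; apply/negP => H.
have : A \subset S.
  apply: S_cut => //; first by rewrite AL.
  have c0 : 0 <= (edge_cut G A)%:R :> R by [].
  have L0' : 0 < L%:R :> R by rewrite ltr0n.
  have : L%:R * (edge_cut G A)%:R <= #|A|%:R :> R by rewrite -natrM ler_nat ltnW.
  move=> h; rewrite -(ler_pM2l L0'); apply: (le_trans h).
  by rewrite mulrA (mulrC L%:R) ler_peMl.
by move=> /fintype.subsetP/(_ _ xA); rewrite (negPf xS).
Qed.

(** As i is not in S, its small component is a tree. By connectedness every proper nonempty subset
    has a boundary edge, which gives the isoperimetric constant K; and 2 K^2 x < 1 by the choice of
    E. *)
Lemma eigenvector_small (v : 'rV[R]_N) x i : 0 < x -> x < E ->
  v *m lap = x *: v -> i \in small_vertices -> i \notin S -> v 0 i = 0.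
Proof.
move=> x0 xE vx; rewrite inE => /existsP[A /and4P[iA cA AL /eqP cA0]] iS.
have inn : (#|G :&: inner_edges A| < #|A|)%N.
  rewrite ltnNge; apply/negP => H; have := S_cycle cA (ltnW (leq_trans AL LM)) H.
  by move=> /fintype.subsetP/(_ _ iA); rewrite (negPf iS).
have /andP[A0 _] := cA.
have K0 : (0 < K)%N by rewrite addn1.
apply: (eigenvector_small_component K0 A0 cA0 _ x0 _ vx) => //.
  move=> B BA; have [->|B0] := eqVneq B finset.set0; first by rewrite big_set0.
  have [k [l [kB lA lB kl]]] := connP cA BA B0.
  have : (0 < edge_cut G B)%N.
    rewrite /edge_cut (bigD1 k) //= (bigD1 l) ?inE //= kl.
    by rewrite -addnA ltn_addr.
  have : (#|G :&: inner_edges B| <= #|G :&: inner_edges A|)%N.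
    apply: subset_leq_card; apply: finset.setIS; apply/fintype.subsetP => e.
    rewrite !inE => /andP[-> /= eB]; exact: fintype.subset_trans eB (fintype.proper_sub BA).
  have := proper_card BA; rewrite sum_degreeS //.
  by move=> BA' eBA c0; apply: (linear_cut_bound c0); move: inn AL BA' eBA; clear; lia.
have : 0 <= (3 * L + 1)%:R ^+ 2 :> R by rewrite sqr_ge0.
move: EL; set t := _ ^+ 2 => tE t0.
have : t * x <= t * E by rewrite ler_wpM2l // ltW.
lra.
Qed.

(** Degrees on U are at most D, so the Laplacian compressed to U is at most 2 D. Dividing by [C]
    makes T a positive contraction, for which small eigenvalues of the Laplacian become values near
    1. *)
Let T : 'M[R]_N := restrict_mx R U *m (1%:M - C^-1 *: lap) *m restrict_mx R U.

Let C0 : 0 < C. Proof. by rewrite ltr0n muln_gt0. Qed.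

Let restrict_sym : (restrict_mx R U)^T = restrict_mx R U.
Proof. exact: tr_diag_mx. Qed.

Let dotT u : dot (u *m T) u = dot (u *m restrict_mx R U) (u *m restrict_mx R U) -
  C^-1 * dot (u *m restrict_mx R U *m lap) (u *m restrict_mx R U).
Proof.
rewrite /T !mulmxA dot_mulmx restrict_sym mulmxBr mulmx1 dotBl -scalemxAr dotZl.
by [].
Qed.

Let Tsym : T^T = T.
Proof.
rewrite /T !trmx_mul restrict_sym linearB /= trmx1 linearZ /= laplacian_sym //.
by rewrite mulmxA.
Qed.

Let T_ge0 u : 0 <= dot (u *m T) u.
Proof.
rewrite dotT subr_ge0 ler_pdivrMl //; apply: lap_le => // i.
rewrite restrict_mxE; case: ifP => [|_]; last by rewrite eqxx.
by rewrite !inE negb_or => /andP[/S_degree].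
Qed.

Let T_le1 u : dot (u *m T) u <= dot u u.
Proof.
rewrite dotT; apply: le_trans (dot_restrict_le u U).
by rewrite gerBl mulr_ge0 ?invr_ge0 ?lap_ge0 // ltW.
Qed.

Let supp (u : 'rV[R]_N) : {set 'I_N} := [set i | u 0 i != 0]%SET.

Let lap_gap_supp (u : 'rV[R]_N) : supp u \subset U -> (#|supp u| <= M)%N ->
  4 * E * dot u u <= dot (u *m lap) u.
Proof.
move=> uU uM; have K0 : (0 < K)%N by rewrite addn1.
have /(lap_gap K0) : forall A : {set 'I_N}, A \subset supp u ->
     (\sum_(i in A) (degree G i).+1 <= K * edge_cut G A)%N.
  move=> A Au; apply: isoperimetric; first exact: fintype.subset_trans Au uU.
  by rewrite (leq_trans _ uM) // subset_leq_card.
have := lap_ge0 G u; have := dot_ge0 u; move: EL.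
set x := dot u u; set y := dot _ _; set k := _ ^+ 2 => kE x0 y0 H.
have k0 : 0 <= k by rewrite sqr_ge0.
have : 4 * E * x <= 4 * E * (2 * k * y) by apply: ler_wpM2l H; rewrite mulr_ge0 // ltW.
have : 8 * k * E * y <= 1 * y by rewrite ler_wpM2r.
lra.
Qed.

Let supp_restrict u : supp (u *m restrict_mx R U) \subset U :&: supp u.
Proof.
apply/fintype.subsetP => i; rewrite finset.in_setI inE restrict_mxE [i \in supp u]inE.
by case: ifP => //; rewrite eqxx.
Qed.

(** Restricting to U keeps the support small, so the local gap 4 E applies to the restricted
    vector. *)
Let T_decay u : (#|supp u| <= M)%N ->
  dot (u *m T) u <= (1 - C^-1 * (4 * E)) * dot u u.
Proof.
move=> uM; rewrite dotT; set u' := u *m _.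
have u'u : dot u' u' <= dot u u by exact: dot_restrict_le.
have : 4 * E * dot u' u' <= dot (u' *m lap) u'.
  apply: lap_gap_supp; first exact: fintype.subset_trans (supp_restrict u) (finset.subsetIl _ _).
  apply: leq_trans uM; apply: subset_leq_card.
  exact: fintype.subset_trans (supp_restrict u) (finset.subsetIr _ _).
rewrite -(ler_pM2l (_ : 0 < C^-1)) ?invr_gt0 // => h.
have : 0 <= (1 - C^-1 * (4 * E)) * (dot u u - dot u' u').
  rewrite mulr_ge0 ?subr_ge0 // ler_pdivrMl // mulr1.
  have : 1 <= D%:R :> R by rewrite ler1n.
  have : 4 <= (3 * L + 1)%:R :> R by rewrite ler_nat; lia.
  move: EL; set k := (3 * L + 1)%:R; rewrite natrM => kE k4 D1.
  have : 16 <= k ^+ 2 by exact: sqr_ge16.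
  move=> /(ler_wpM2r (ltW E0)); lra.
lra.
Qed.

(** T reaches only the closed neighbourhoods of the support vertices in U, where degrees are at most
    D. *)
Let supp_T u : (#|supp (u *m T)| <= D.+1 * #|supp u|)%N.
Proof.
set u' := u *m restrict_mx R U.
have uT : u *m T = (u' - C^-1 *: (u' *m lap)) *m restrict_mx R U.
  by rewrite /T !mulmxA mulmxBr mulmx1 -scalemxAr.
pose nbh i : {set 'I_N} := (i |: [set k | adj G i k])%SET.
have sub : supp (u *m T) \subset \big[@finset.setU _/finset.set0]_(i in U :&: supp u) nbh i.
  apply/fintype.subsetP => k; rewrite inE uT restrict_mxE; case: ifP => [kU|_]; last by rewrite eqxx.
  apply: contraNT => /finset.bigcupP kn.
  have nk i : i \in U :&: supp u -> k \notin nbh i.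
    by move=> iU; apply/negP => ki; apply: kn; exists i.
  have u'0 i : i \notin U :&: supp u -> u' 0 i = 0.
    move=> iU; apply/eqP; apply: contraNT iU => ui.
    by apply: (fintype.subsetP (supp_restrict u)); rewrite inE.
  have u'k : u' 0 k = 0.
    by apply: u'0; apply/negP => /nk; rewrite !inE eqxx.
  rewrite [X in X == 0]mxE u'k add0r [X in X == 0]mxE [X in - X]mxE mxE big1 ?mulr0 ?oppr0 //.
  move=> i _; have [iU|iU] := boolP (i \in U :&: supp u); last by rewrite u'0 ?mul0r.
  have := nk _ iU; rewrite !inE negb_or => /andP[ki ik].
  by rewrite !mxE eq_sym (negPf ki) -/(adj G i k) (negPf ik) mulr0n subr0 mulr0.
apply: leq_trans (subset_leq_card sub) _.
apply: leq_trans (card_bigcup_le _ _) _.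
rewrite mulnC -sum_nat_const.
apply: (@leq_trans (\sum_(i in U :&: supp u) D.+1)%N); last first.
  by rewrite !sum_nat_const leq_mul2r subset_leq_card ?orbT // finset.subsetIr.
apply: leq_sum => i; rewrite finset.in_setI !inE negb_or => /andP[/andP[/S_degree iD _] _].
rewrite cardsU1; rewrite -add1n leq_add //; first by case: (_ \notin _).
Qed.

Let th : R := 1 - C^-1 * E.

Let rho_ge0 : 0 <= 1 - C^-1 * (4 * E).
Proof.
rewrite subr_ge0 ler_pdivrMl // mulr1.
have : 1 <= D%:R :> R by rewrite ler1n.
have : 4 <= (3 * L + 1)%:R :> R by rewrite ler_nat; lia.
move: EL; set k := (3 * L + 1)%:R; rewrite natrM => kE k4 D1.
have : 16 <= k ^+ 2 by exact: sqr_ge16.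
by move=> /(ler_wpM2r (ltW E0)); lra.
Qed.

Let EC_ge0 : 0 < C^-1 * E. Proof. by rewrite mulr_gt0 ?invr_gt0. Qed.

Let th_gt0 : 0 < th.
Proof. by move: rho_ge0 EC_ge0; rewrite /th mulrCA; lra. Qed.

(** Bernoulli's inequality. The factor 4 in the local gap thus turns into the fourth power of [th],
    the value of 1 - x / C at the threshold x = E. *)
Let rho_le : 1 - C^-1 * (4 * E) <= th ^+ 4.
Proof.
move: EC_ge0; rewrite /th mulrCA; set y := C^-1 * E => y0.
rewrite (_ : (1 - y) ^+ 4 = ((1 - y) ^+ 2) ^+ 2) -?exprM //.
have h1 : 1 - 2 * y <= (1 - y) ^+ 2 by nra.
have := sqr_ge0 ((1 - y) ^+ 2 - 1); lra.
Qed.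

(** As long as k < 2 ^ j, the support has at most M vertices, so [contraction_sqr] and [T_decay]
    together gain a factor th^4 in the squared norm at the next step. *)
Let iter_T (i : 'I_N) k : (k <= 2 ^ j)%N ->
  (#|supp (@delta_mx R 1 N ord0 i *m T ^+ k)| <= D.+1 ^ k)%N /\
  dot (@delta_mx R 1 N ord0 i *m T ^+ k) (@delta_mx R 1 N ord0 i *m T ^+ k) <= th ^+ (4 * k).
Proof.
elim: k => [_|k IH kj].
  rewrite expr0 muln0 !expr0 expn0 mulmx1; split.
    apply: (@leq_trans #|[set i]%SET|); last by rewrite cards1.
    apply: subset_leq_card; apply/fintype.subsetP => l.
    by rewrite !inE mxE eqxx /=; case: (l == i); rewrite ?eqxx.
  rewrite /dot (bigD1 i) //= big1 ?mxE ?eqxx ?mulr1 ?addr0 // => l li.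
  by rewrite mxE (negPf li) mul0r.
have [su du] := IH (ltnW kj).
rewrite exprSr mulmxA; set u := @delta_mx R 1 N ord0 i *m _ in su du *; split.
  by apply: leq_trans (supp_T u) _; rewrite expnS leq_mul2l.
have uM : (#|supp u| <= M)%N.
  by apply: leq_trans su (leq_trans _ DM); rewrite leq_pexp2l // ltnW.
apply: le_trans (contraction_sqr Tsym T_ge0 T_le1 u) _.
apply: le_trans (T_decay uM) _.
by rewrite mulnS exprD; apply: ler_pM => //; rewrite dot_ge0.
Qed.

(** Asking the eigenvectors to vanish on S costs at most |S| dimensions. On the space W' that is
    left T is at least [th]; with n = 2 ^ j, the trace of T^(2n) is then at least rank(W') th^(2n),
    and at most N th^(4n) by [iter_T], so that the rank is at most N th^(2n). *)
Lemma eig_count_le : (eig_count lap `]0, E[%classic)%:R <=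
  #|S|%:R + N%:R * (1 - C^-1 * E) ^+ (2 ^ j.+1).
Proof.
have [W [rW Wker Wform]] := eig_count_space (laplacian_sym R G) `]0, E[%classic.
pose BS : 'M[R]_(N, #|S|) := \matrix_(i, k) (i == enum_val k)%:R.
have vBS (v : 'rV[R]_N) : v *m BS = 0 -> forall i, i \in S -> v 0 i = 0.
  move=> vB i iS; have /rowP/(_ (enum_rank_in iS i)) := vB.
  rewrite mxE [RHS]mxE (bigD1 i) //= big1 ?addr0 => [|k ki]; last first.
    by rewrite mxE enum_rankK_in // (negPf ki) mulr0.
  by rewrite mxE enum_rankK_in // eqxx mulr1.
pose W' := (W :&: kermx BS)%MS.
have rW' : (\rank W <= #|S| + \rank W')%N.
  by rewrite -(mxrank_mul_ker W BS) leq_add2r rank_leq_col.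
have W'0 (v : 'rV[R]_N) i : (v <= W')%MS -> i \in S :|: small_vertices -> v 0 i = 0.
  rewrite sub_capmx => /andP[vW /sub_kermxP vB].
  rewrite finset.in_setU; have [iS|iS /= ism] := boolP (i \in S); first by move=> _; exact: vBS.
  (* Every eigenvector in question vanishes at i; testing with this column extends the vanishing to
     W. *)
  have Wi : W *m (delta_mx i 0 : 'cV_N) = 0.
    apply: Wker => x v'; rewrite set_itvE /= => /andP[x0 xE] v'x.
    by apply/colP => k; rewrite ord1 -colE !mxE (eigenvector_small x0 xE v'x).
  have /submxP[w vw] := vW.
  have : v *m (delta_mx i 0 : 'cV_N) = 0 by rewrite vw -mulmxA Wi mulmx0.
  by move/colP/(_ 0); rewrite -colE !mxE.
have W'U (v : 'rV[R]_N) : (v <= W')%MS -> v *m restrict_mx R U = v.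
  move=> vW; apply/rowP => i; rewrite restrict_mxE finset.in_setC.
  by case: ifP => // /negbFE iS; rewrite W'0.
have form (v : 'rV[R]_N) : (v <= W')%MS -> th * dot v v <= dot (v *m T) v.
  move=> vW; rewrite dotT W'U // /th mulrBl mul1r lerD2l lerN2 -mulrA ler_pM2l ?invr_gt0 //.
  apply: Wform; last by move: vW; rewrite sub_capmx => /andP[].
  by move=> x; rewrite set_itvE /= => /andP[_ /ltW].
have e2 : (2 ^ j.+1 = 2 ^ j + 2 ^ j)%N by rewrite expnS mul2n addnn.
have h : (\rank W')%:R * th ^+ (2 ^ j.+1) <= \tr (T ^+ (2 ^ j.+1)).
  apply: rank_le_trace => u.
    by rewrite e2 psd_pow_dbl // dot_ge0.
  by move=> uW; apply: psd_pow_ge => //; [exact: ltW|exact: form].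
have tr_le : \tr (T ^+ (2 ^ j.+1)) <= N%:R * (th ^+ (2 ^ j.+1) * th ^+ (2 ^ j.+1)).
  rewrite /mxtrace mulr_natl -[N in _ *+ N]card_ord -sumr_const; apply: ler_sum => i _.
  rewrite -dot_delta e2 psd_pow_dbl //.
  have [_] := @iter_T i (2 ^ j) (leqnn _).
  by rewrite -exprD !addnn -!muln2 -mulnA mulnC.
have := le_trans h tr_le; rewrite mulrA ler_pM2r ?exprn_gt0 // => rk.
rewrite -rW; apply: (@le_trans _ _ (#|S| + \rank W')%:R); first by rewrite ler_nat.
by rewrite natrD lerD2l.
Qed.

End Count.

(** * Expectations over random graphs *)

Section ProductSum.
Variables (R : comNzRingType) (T : finType).
Implicit Types (D G H : {set T}).

Lemma sum_powersetU1 (D : {set T}) (x : T) (F : {set T} -> R) : x \notin D ->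
  \sum_(G in powerset (x |: D)) F G =
  \sum_(G in powerset D) F G + \sum_(G in powerset D) F (x |: G)%SET.
Proof.
move=> xD; rewrite (bigID (fun G : {set T} => x \notin G)) /=; congr (_ + _).
  apply: eq_bigl => G; rewrite !powersetE; apply/andP/idP => [[GD xG]|GD].
    apply/fintype.subsetP => y yG; have := fintype.subsetP GD _ yG.
    by rewrite !inE => /orP[/eqP yx|//]; move: xG; rewrite -yx yG.
  split; first by rewrite (fintype.subset_trans GD) // finset.subsetUr.
  by apply: contra xD; exact: (fintype.subsetP GD).
rewrite (reindex_onto (fun G => x |: G)%SET (fun G => G :\ x)%SET) /=; last first.
  by move=> G; rewrite negbK => /andP[_ xG]; exact: finset.setD1K.
apply: eq_bigl => G; rewrite !powersetE setU11 /= andbT.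
apply/andP/idP => [[GD /eqP GE]|GD].
  have xG : x \notin G by rewrite -GE !inE eqxx.
  apply/fintype.subsetP => y yG; have : y \in x |: D.
    by apply: (fintype.subsetP GD); rewrite !inE yG orbT.
  by rewrite !inE => /orP[/eqP yx|//]; move: xG; rewrite -yx yG.
split; first exact: finset.setUS.
by rewrite setU1K //; apply: contra xD; exact: (fintype.subsetP GD).
Qed.

(** Independence in finite form: the coordinates outside E0 are summed out one at a time, each
    giving its total weight, while F sees only those in E0. *)
Lemma sum_product_powerset D (E0 : {set T}) (u : T -> bool -> R) (F : {set T} -> R) :
  E0 \subset D ->
  \sum_(G in powerset D) (\prod_(e in D) u e (e \in G)) * F (G :&: E0) =
  (\sum_(H in powerset E0) (\prod_(e in E0) u e (e \in H)) * F H) *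
  \prod_(e in D :\: E0) (u e true + u e false).
Proof.
have [m] := ubnP #|D :\: E0|; elim: m D => // m IH D Dm E0D.
have [DE|[x]] := set_0Vmem (D :\: E0).
  rewrite DE big_set0 mulr1.
  have -> : D = E0.
    by apply/eqP; rewrite finset.eqEsubset E0D andbT -finset.setD_eq0 DE.
  by apply: eq_bigr => G; rewrite powersetE => /finset.setIidPl ->.
rewrite inE => /andP[xE xD].
have D'E : D = (x |: D :\ x)%SET by rewrite finset.setD1K.
set D' := (D :\ x)%SET in D'E.
have xD' : x \notin D' by rewrite !inE eqxx.
have E0D' : E0 \subset D'.
  apply/fintype.subsetP => y yE; rewrite !inE (fintype.subsetP E0D) // andbT.
  by apply: contraNneq xE => <-.
have DE : (D :\: E0 = x |: (D' :\: E0))%SET.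
  rewrite {1}D'E finset.setDUl; congr finset.setU.
  by apply/finset.setP => y; rewrite !inE; case: eqP => [->|]; rewrite ?xE // andbF.
have xDE : x \notin D' :\: E0 by rewrite !inE eqxx andbF.
rewrite DE big_setU1 //= mulrCA -IH //; last first.
  by move: Dm; rewrite DE cardsU1 xDE.
rewrite {1}D'E sum_powersetU1 // mulrDl addrC; congr (_ + _).
  rewrite mulr_sumr; apply: eq_bigr => G; rewrite powersetE => GD.
  rewrite D'E big_setU1 //= setU11 -mulrA; congr (_ * (_ * _)).
    apply: eq_bigr => e eD'; rewrite !inE; case: eqP => // ex.
    by move: xD'; rewrite -ex eD'.
  congr F; apply/finset.setP => y; rewrite !inE.
  by case: eqP => [->|//]; rewrite (negPf xE) !andbF.
rewrite mulr_sumr; apply: eq_bigr => G; rewrite powersetE => GD.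
rewrite D'E big_setU1 //= -mulrA (_ : x \in G = false) //.
by apply/negP => /(fintype.subsetP GD); rewrite (negPf xD').
Qed.

End ProductSum.

Section ErdosRenyi.
Variables (R : realType) (N : nat).
Implicit Types (p : R) (G : {set {set 'I_N}}) (A : {set 'I_N}).

Definition edge_weight p (b : bool) : R := if b then p else 1 - p.

Lemma er_pmfE p G : 0 <= p <= 1 ->
  er_pmf p G = \prod_(e in edges N) edge_weight p (e \in G).
Proof.
have in1 (a b : bool) : (a \in [set b]%classic) = (a == b).
  by apply/idP/eqP => [/set_mem //|->]; exact/mem_set.
move=> p01; apply: eq_bigr => e _; rewrite bernoulli_probE // !diracE !in1.
rewrite -!EFinM -EFinD; case: (e \in G) => /=.
  by rewrite mulr1 mulr0 addr0.
by rewrite mulr1 mulr0 add0r.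
Qed.

Lemma er_sum p (I : Type) (r : seq I) (P : pred I) (X : I -> {set {set 'I_N}} -> R) :
  er_expectation p (fun G => \sum_(i <- r | P i) X i G) =
  \sum_(i <- r | P i) er_expectation p (X i).
Proof.
rewrite /er_expectation exchange_big; apply: eq_bigr => G _.
by rewrite mulr_sumr.
Qed.

Lemma er_add p X Y : er_expectation p (fun G => X G + Y G) =
  er_expectation p X + er_expectation p Y.
Proof.
by rewrite /er_expectation -big_split; apply: eq_bigr => G _; rewrite mulrDr.
Qed.

Lemma er_scale p (c : R) X : er_expectation p (fun G => c * X G) =
  c * er_expectation p X.
Proof.
by rewrite /er_expectation mulr_sumr; apply: eq_bigr => G _; rewrite mulrCA.
Qed.

Lemma er_le p X Y : (forall G, G \subset edges N -> X G <= Y G) ->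
  er_expectation p X <= er_expectation p Y.
Proof.
move=> XY; apply: ler_sum => G; rewrite powersetE => GE.
by rewrite ler_wpM2l ?er_pmf_ge0 ?XY.
Qed.

(** The edges outside E0 integrate out as independent factors. This serves with E0 the inner edges
    of a set and u a function of its boundary edges. *)
Lemma er_product p (E0 : {set {set 'I_N}}) F (u : {set 'I_N} -> bool -> R) :
  0 <= p <= 1 -> E0 \subset edges N ->
  er_expectation p (fun G => F (G :&: E0) * \prod_(e in edges N :\: E0) u e (e \in G)) =
  (\sum_(H in powerset E0) (\prod_(e in E0) edge_weight p (e \in H)) * F H) *
  \prod_(e in edges N :\: E0) (p * u e true + (1 - p) * u e false).
Proof.
move=> p01 E0E.
pose v e b := edge_weight p b * (if e \in E0 then 1 else u e b).
transitivity (\sum_(G in powerset (edges N)) (\prod_(e in edges N) v e (e \in G)) * F (G :&: E0)).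
  apply: eq_bigr => G _; rewrite er_pmfE // mulrCA mulrC; congr (_ * _).
  rewrite big_split /=; congr (_ * _).
  rewrite [RHS](bigID (mem E0)) /= [X in X * _]big1 ?mul1r; last by move=> e /andP[_ ->].
  apply: eq_big => e; first by rewrite finset.in_setD andbC.
  by rewrite finset.in_setD => /andP[/negPf ->].
rewrite sum_product_powerset //; congr (_ * _).
  by apply: eq_bigr => H _; congr (_ * _); apply: eq_bigr => e eE; rewrite /v eE mulr1.
by apply: eq_bigr => e; rewrite finset.in_setD => /andP[/negPf eE _]; rewrite /v eE.
Qed.

Lemma er_prod p (u : {set 'I_N} -> bool -> R) : 0 <= p <= 1 ->
  er_expectation p (fun G => \prod_(e in edges N) u e (e \in G)) =
  \prod_(e in edges N) (p * u e true + (1 - p) * u e false).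
Proof.
move=> p01; have := @er_product p finset.set0 (fun _ => 1) u p01 (finset.sub0set _).
rewrite finset.setD0 powerset0 big_set1 big_set0 !mulr1 mul1r => <-.
by apply: eq_bigr => G _; rewrite mul1r.
Qed.

Lemma er_const p (c : R) : 0 <= p <= 1 -> er_expectation p (fun _ : {set {set 'I_N}} => c) = c.
Proof.
move=> p01; transitivity (c * er_expectation p (fun G => \prod_(e in edges N) 1)).
  by rewrite -er_scale; apply: eq_bigr => G _; rewrite big1 // mulr1.
rewrite (@er_prod p (fun _ _ => 1) p01) big1 ?mulr1 // => e _; ring.
Qed.

Lemma er_subset p (F : {set {set 'I_N}}) : 0 <= p <= 1 -> F \subset edges N ->
  er_expectation p (fun G => (F \subset G)%:R) = p ^+ #|F|.
Proof.
move=> p01 FE; pose u (e : {set 'I_N}) b : R := if e \in F then b%:R else 1.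
transitivity (er_expectation p (fun G => \prod_(e in edges N) u e (e \in G))).
  apply: eq_bigr => G _; congr (_ * _).
  have [FG|/fintype.subsetPn[e eF eG]] := boolP (F \subset G).
    by rewrite big1 // => e _; rewrite /u; case: ifP => // /(fintype.subsetP FG) ->.
  by rewrite (bigD1 e) ?(fintype.subsetP FE) //= /u eF (negPf eG) mul0r.
rewrite (er_prod u p01) -prodr_const big_mkcond [RHS]big_mkcond; apply: eq_bigr => e _.
rewrite /u; case eF: (e \in F); first by rewrite (fintype.subsetP FE) //= mulr1 mulr0 addr0.
by case: ifP => // _; ring.
Qed.

End ErdosRenyi.

(** * Connected sets, components and counts of edges *)

Section Combinatorics.
Variable N : nat.
Implicit Types (G H : {set {set 'I_N}}) (A B : {set 'I_N}).

(** Makes the connectedness of A an event of its inner edges alone, as [er_product] requires. *)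
Lemma conn_inner G A : G \subset edges N -> conn (G :&: inner_edges A) A = conn G A.
Proof.
move=> GE; congr (_ && _); apply: eq_forallb => B; case BA: (B \proper A) => //=.
congr (_ ==> _); apply: eq_existsb => i; case iB: (i \in B) => //=.
apply: eq_existsb => j; case jAB: (j \in A :\: B) => //=.
rewrite /adj finset.in_setI; case ijG: ([set i; j]%SET \in G) => //=.
rewrite inE (fintype.subsetP GE) //=.
rewrite finset.subUset !finset.sub1set (fintype.subsetP (fintype.proper_sub BA) _ iB).
by move: jAB; rewrite inE => /andP[_ ->].
Qed.

Lemma card_cut_edges A : #|cut_edges A| = (#|A| * (N - #|A|))%N.
Proof.
(* The boundary of A is counted in the complete graph. *)
have := @cut_edgesE N (edges N) (fintype.subxx _) A.
have -> : (edges N :&: cut_edges A)%SET = cut_edges A.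
  by apply/finset.setIidPr; apply/fintype.subsetP => e; rewrite inE => /andP[].
move=> <-; have -> : (N - #|A|)%N = #|(~: A)%SET|.
  by rewrite [RHS]cardsCs finset.setCK card_ord.
rewrite /edge_cut -sum_nat_const.
apply: eq_bigr => i iA; rewrite -sum1_card; apply: eq_bigr => j.
rewrite inE => jA; rewrite /adj inE cards2; case: (i =P j) => [ij|//].
by move: jA; rewrite -ij iA.
Qed.

Lemma cut_edges_sub A : cut_edges A \subset edges N :\: inner_edges A.
Proof.
apply/fintype.subsetP => e; rewrite !inE => /andP[e2 e1]; rewrite e2 andbT /=.
by apply/negP => /finset.setIidPl eA; move: e1; rewrite eA (eqP e2).
Qed.

Lemma inner_edges_sub A : inner_edges A \subset edges N.
Proof. by apply/fintype.subsetP => e; rewrite inE => /andP[]. Qed.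

Lemma card_inner_edges A : (#|inner_edges A| <= 2 ^ #|A|)%N.
Proof.
rewrite -card_powerset; apply: subset_leq_card; apply/fintype.subsetP => e.
by rewrite powersetE inE => /andP[].
Qed.

Lemma component_eq G A B x : conn G A -> conn G B -> edge_cut G A = 0%N ->
  edge_cut G B = 0%N -> x \in A -> x \in B -> A = B.
Proof.
have sub A' B' : conn G A' -> edge_cut G B' = 0%N -> x \in A' -> x \in B' -> A' \subset B'.
  move=> cA /eqP cB xA xB; apply: contraT => AB.
  have ABp : (A' :&: B' \proper A')%SET.
    rewrite finset.properEneq finset.subsetIl andbT.
    by apply: contra AB => /eqP/finset.setIidPl.
  have AB0 : (A' :&: B')%SET != finset.set0 by apply/finset.set0Pn; exists x; rewrite inE xA.
  have [i [j [iAB jA jAB ij]]] := connP cA ABp AB0.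
  move: cB; rewrite sum_nat_eq0 => /forall_inP/(_ i).
  move: iAB; rewrite inE => /andP[_ iB] /(_ iB); rewrite sum_nat_eq0.
  move=> /forall_inP/(_ j); rewrite ij inE; apply.
  by apply: contra jAB => jB; rewrite inE jA.
by move=> cA cB A0 B0 xA xB; apply/eqP; rewrite finset.eqEsubset !sub.
Qed.

(** Components are disjoint. Averaged over the critical graph, this takes the place of a count of
    trees. *)
Lemma sum_components G :
  (\sum_(A : {set 'I_N} | conn G A && (edge_cut G A == 0%N)) #|A| <= N)%N.
Proof.
pose P := [set A : {set 'I_N} | conn G A && (edge_cut G A == 0%N)]%SET.
have tP : finset.trivIset P.
  apply/finset.trivIsetP => A B; rewrite !inE => /andP[cA /eqP A0] /andP[cB /eqP B0].
  apply: contraR; rewrite -finset.setI_eq0 => /finset.set0Pn[x].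
  by rewrite inE => /andP[xA xB]; apply/eqP; apply: (component_eq cA cB A0 B0 xA xB).
rewrite (eq_bigl (fun A => A \in P)) => [|A]; last by rewrite inE.
by move: tP; rewrite /finset.trivIset => /eqP ->; rewrite -[leqRHS]card_ord max_card.
Qed.

Lemma ffact_le n m : (n ^_ m <= n ^ m)%N.
Proof.
elim: m => [|m IH]; first by rewrite ffactn0.
by rewrite ffactnSr expnSr leq_mul // leq_subr.
Qed.

Lemma bin_le_exp n m : ('C(n, m) <= n ^ m)%N.
Proof.
apply: leq_trans (ffact_le n m); rewrite -bin_ffact.
by rewrite leq_pmulr // fact_gt0.
Qed.

End Combinatorics.

(** * The expected size of the bad set *)

Section BadSet.
Variables (R : realType) (N : nat) (lam : R).
Hypotheses (lam1 : 1 < lam) (lamN : lam <= N%:R).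
Variables (L D M : nat) (s eps gam : R).
Hypotheses (s0 : 0 <= s) (gam0 : 0 <= gam) (NM : lam * M%:R ^+ 2 <= N%:R).
Hypothesis gamE : ln lam + 1 + s * eps - lam * (1 - expR (- s)) <= - gam.
Implicit Types (G H : {set {set 'I_N}}) (A B : {set 'I_N}).
Local Notation p := (lam / N%:R).

Definition bad_cycle G A := [&& conn G A, (#|A| <= M)%N &
  (#|A| <= #|G :&: inner_edges A|)%N].

(** The bound on the inner edges leaves only trees, for which the change of measure costs at most
    |A| factors lam; the other connected sets of at most M vertices are bad cycles. *)
Definition bad_cut G A := [&& conn G A, (L <= #|A| <= M)%N,
  (#|G :&: inner_edges A| < #|A|)%N & (edge_cut G A)%:R <= eps * #|A|%:R].

Definition bad_set G : {set 'I_N} := [set i | [|| (D < degree G i)%N,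
  [exists A : {set 'I_N}, (i \in A) && bad_cycle G A] |
  [exists A : {set 'I_N}, (i \in A) && bad_cut G A]]]%SET.

Lemma card_bad_set G : (#|bad_set G| <= \sum_i (D < degree G i)%N +
  (\sum_(A : {set 'I_N}) #|A| * bad_cycle G A + \sum_(A : {set 'I_N}) #|A| * bad_cut G A))%N.
Proof.
have ex (P : {set 'I_N} -> bool) : (\sum_i [exists A : {set 'I_N}, (i \in A) && P A] <=
    \sum_(A : {set 'I_N}) #|A| * P A)%N.
  apply: (@leq_trans (\sum_i \sum_(A : {set 'I_N}) (i \in A) * P A)%N).
    apply: leq_sum => i _; case: existsP => // -[A /andP[iA PA]].
    by rewrite (bigD1 A) //= iA PA.
  rewrite exchange_big; apply: leq_sum => A _; rewrite -big_distrl leq_mul2r.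
  by rewrite -sum1_card [X in (_ <= X)%N]big_mkcond leqnn orbT.
rewrite (leq_trans _ (leq_add (leqnn _) (leq_add (ex _) (ex _)))) //.
rewrite -!big_split -sum1_card big_mkcond; apply: leq_sum => i _ /=.
by rewrite inE; do 3 case: (X in X || _); case: [exists _, _].
Qed.

Let N0 : 0 < N%:R :> R. Proof. by apply: lt_le_trans lamN; apply: lt_trans lam1. Qed.
Let p01 : 0 <= p <= 1.
Proof. by rewrite divr_ge0 ?ler_pdivrMr ?mul1r // ltW // (lt_trans _ lam1). Qed.

(** Markov's inequality, as every degree has mean at most lam. *)
Lemma er_degree : er_expectation p (fun G => (\sum_i (D < degree G i)%N)%:R) <=
  N%:R * (lam / D.+1%:R).
Proof.
have adjp (i j : 'I_N) : er_expectation p (fun G => (adj G i j)%:R) <= p.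
  have [ijE|ijE] := boolP ([set i; j]%SET \in edges N).
    have FE : ([set [set i; j]] \subset edges N)%SET by rewrite finset.sub1set.
    have := er_subset p01 FE; rewrite cards1 expr1 => {2}<-.
    by apply: er_le => G _; rewrite finset.sub1set.
  have p0 : 0 <= p by case/andP: p01.
  apply: le_trans p0; rewrite -(er_const N 0 p01); apply: er_le => G GE.
  by rewrite /adj; case: ([set i; j]%SET \in G) / boolP => // /(fintype.subsetP GE); rewrite (negPf ijE).
apply: (@le_trans _ _ (\sum_(i < N) \sum_(j < N) D.+1%:R^-1 * p)); last first.
  rewrite !sumr_const card_ord -[leLHS]mulr_natl -[X in _ * X <= _]mulr_natl.
  by rewrite ler_wpM2l // mulrCA [N%:R * _]mulrC divfK ?gt_eqF // mulrC.
apply: (@le_trans _ _ (\sum_(i < N) \sum_(j < N) D.+1%:R^-1 *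
    er_expectation p (fun G => (adj G i j)%:R))); last first.
  by apply: ler_sum => i _; apply: ler_sum => j _; rewrite ler_wpM2l.
under eq_bigr do rewrite -mulr_sumr -er_sum.
rewrite -mulr_sumr -er_sum -er_scale; apply: er_le => G _.
rewrite natr_sum mulr_sumr; apply: ler_sum => i _.
rewrite -natr_sum -degreeE ler_pdivlMl //.
by case: ltnP => [h|_]; rewrite ?mulr1 ?mulr0 // ler_nat.
Qed.

(** A union bound over the sets F of at least |A| inner edges, each present with probability at most
    p^|A|. There are at most N^a sets A of size a, and N^a p^a = lam^a, so the bound does not grow
    with N and the density of bad cycles vanishes in the limit. *)
Lemma er_bad_cycle : er_expectation p
    (fun G => (\sum_(A : {set 'I_N}) #|A| * bad_cycle G A)%:R) <=
  (M * 2 ^ (2 ^ M))%:R * (M.+1%:R * lam ^+ M).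
Proof.
have lam0 : 0 <= lam by rewrite ltW // (lt_trans _ lam1).
have p0 : 0 <= p by case/andP: p01.
have p1 : p <= 1 by case/andP: p01.
have one A : (#|A| <= M)%N ->
    er_expectation p (fun G => (#|A| * bad_cycle G A)%:R) <= (M * 2 ^ (2 ^ M))%:R * p ^+ #|A|.
  move=> AM; pose Fs := [set F in powerset (inner_edges A) | (#|A| <= #|F|)%N]%SET.
  apply: (@le_trans _ _ (er_expectation p (fun G => #|A|%:R * \sum_(F in Fs) (F \subset G)%:R))).
    apply: er_le => G GE; rewrite natrM ler_wpM2l //.
    case: (boolP (bad_cycle G A)) => [/and3P[_ _ h]|_]; last by rewrite sumr_ge0.
    rewrite (bigD1 (G :&: inner_edges A)%SET) /=.
      by rewrite finset.subsetIl lerDl sumr_ge0.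
    by rewrite inE powersetE finset.subsetIr.
  rewrite er_scale er_sum natrM -mulrA ler_pM ?ler_nat //.
    rewrite sumr_ge0 // => F; rewrite inE powersetE => /andP[FA _].
    by rewrite er_subset ?exprn_ge0 // (fintype.subset_trans FA) ?inner_edges_sub.
  apply: (@le_trans _ _ (\sum_(F in Fs) p ^+ #|A|)).
    apply: ler_sum => F; rewrite inE powersetE => /andP[FA cF].
    rewrite er_subset ?(fintype.subset_trans FA) ?inner_edges_sub //.
    exact: ler_wiXn2l.
  rewrite sumr_const -[leLHS]mulr_natl ler_wpM2r ?exprn_ge0 // ler_nat.
  apply: (@leq_trans #|powerset (inner_edges A)|).
    by apply: subset_leq_card; apply/fintype.subsetP => F; rewrite inE => /andP[].
  rewrite card_powerset leq_pexp2l // (leq_trans (card_inner_edges A)) //.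
  by rewrite leq_pexp2l.
apply: (@le_trans _ _ (\sum_(A : {set 'I_N} | (#|A| <= M)%N) (M * 2 ^ (2 ^ M))%:R * p ^+ #|A|)).
  under [X in er_expectation _ X]funext do rewrite natr_sum.
  rewrite er_sum [leRHS]big_mkcond; apply: ler_sum => A _.
  case: ifP => [/one //|AM].
  rewrite -(er_const N 0 p01); apply: er_le => G _.
  by rewrite /bad_cycle AM andbF muln0.
rewrite -mulr_sumr ler_wpM2l //.
apply: (@le_trans _ _ (\sum_(a < M.+1) \sum_(A : {set 'I_N} | #|A| == a) p ^+ a)).
  rewrite (exchange_big_dep xpredT) //= big_mkcond; apply: ler_sum => A _.
  case: ifP => [AM|_]; last by apply: sumr_ge0 => i _; rewrite exprn_ge0.
  by rewrite (bigD1 (Ordinal (AM : (#|A| < M.+1)%N))) ?eqxx //= lerDl sumr_ge0 // => i _; rewrite exprn_ge0.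
rewrite mulr_natl -[M.+1 in leRHS]card_ord -sumr_const; apply: ler_sum => a _.
rewrite sumr_const -[leLHS]mulr_natl.
have -> : #|[pred A : {set 'I_N} | #|A| == a]| = 'C(N, a).
  by have := card_draws 'I_N a; rewrite card_ord => <-; apply: eq_card => A; rewrite !inE.
apply: (@le_trans _ _ ((N ^ a)%:R * p ^+ a)).
  by rewrite ler_wpM2r ?exprn_ge0 // ler_nat bin_le_exp.
rewrite natrX -exprMn mulrC divfK ?gt_eqF //.
by rewrite ler_eXn2l // -ltnS.
Qed.

Let phi A H : bool := conn H A && (#|H| < #|A|)%N.
(** The probability, for edge density q, that A spans a tree. *)
Let Z q A : R := \sum_(H in powerset (inner_edges A))
  (\prod_(e in inner_edges A) edge_weight q (e \in H)) * (phi A H)%:R.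

Let q01 : 0 <= (N%:R^-1 : R) <= 1.
Proof. by rewrite invr_ge0 ltW //= invf_le1 //; exact: le_trans (ltW lam1) lamN. Qed.

Let Z_ge0 q A : 0 <= q <= 1 -> 0 <= Z q A.
Proof.
case/andP=> q0 q1; apply: sumr_ge0 => H _; rewrite mulr_ge0 //; apply: prodr_ge0 => e _.
by rewrite /edge_weight; case: ifP; rewrite ?subr_ge0.
Qed.

(** Each present edge costs a factor lam, each absent one at most 1, and there are fewer than |A|
    present edges. *)
Let Z_le A : Z p A <= lam ^+ #|A| * Z N%:R^-1 A.
Proof.
have [q0 q1] := andP q01; have [p0 p1] := andP p01.
have w0 (e : {set 'I_N}) (H : {set {set 'I_N}}) : 0 <= edge_weight (N%:R^-1 : R) (e \in H).
  by rewrite /edge_weight; case: ifP; rewrite ?subr_ge0.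
rewrite mulr_sumr; apply: ler_sum => H; rewrite powersetE => HA.
rewrite mulrA; case ph: (phi A H); rewrite ?mulr0 // !mulr1.
apply: (@le_trans _ _ (\prod_(e in inner_edges A)
   ((if e \in H then lam else 1) * edge_weight N%:R^-1 (e \in H)))).
  apply: ler_prod => e _; rewrite /edge_weight; case: ifP => _ //.
    by rewrite p0 /=.
  by rewrite subr_ge0 p1 mul1r lerD2l lerN2 -[leLHS]mul1r ler_wpM2r // ltW.
rewrite big_split /= ler_wpM2r ?prodr_ge0 //.
rewrite -big_mkcondr /= (eq_bigl (mem H)) => [|e]; last first.
  by apply/andP/idP => [[]//|eH]; rewrite (fintype.subsetP HA).
rewrite prodr_const ler_weXn2l ?ltW //; last by case/andP: ph => _ /ltnW.
Qed.

Let prod_cut A (c : R) : \prod_(e in edges N :\: inner_edges A)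
   (if e \in cut_edges A then c else 1) = c ^+ (#|A| * (N - #|A|)).
Proof.
rewrite -big_mkcondr /= -card_cut_edges -prodr_const; apply: eq_bigl => e.
by apply/andP/idP => [[]//|eH]; rewrite (fintype.subsetP (cut_edges_sub A)).
Qed.

Let prod_cut_G A G (c : R) : G \subset edges N ->
  \prod_(e in edges N :\: inner_edges A)
   (if (e \in cut_edges A) && (e \in G) then c else 1) = c ^+ edge_cut G A.
Proof.
move=> GE; rewrite -big_mkcondr /= cut_edgesE // -prodr_const; apply: eq_bigl => e.
rewrite [RHS]finset.in_setI [RHS]andbC.
by apply/andP/idP => [[]//|/[dup] /andP[eH _] ->]; rewrite (fintype.subsetP (cut_edges_sub A)).
Qed.

Let er_component A : Z N%:R^-1 A * (1 - N%:R^-1) ^+ (#|A| * (N - #|A|)) <=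
  er_expectation N%:R^-1 (fun G => (conn G A && (edge_cut G A == 0%N))%:R).
Proof.
(* The product of u is 0 to the power of the number of boundary edges; as 0 ^ 0 = 1, it is the
   indicator that A has no boundary. *)
pose u (e : {set 'I_N}) b : R := if (e \in cut_edges A) && b then 0 else 1.
have := @er_product R N N%:R^-1 (inner_edges A) (fun H => (phi A H)%:R) u q01 (inner_edges_sub A).
rewrite -/(Z N%:R^-1 A).
have -> : \prod_(e in edges N :\: inner_edges A)
    (N%:R^-1 * u e true + (1 - N%:R^-1) * u e false) = (1 - N%:R^-1) ^+ (#|A| * (N - #|A|)).
  rewrite -prod_cut; apply: eq_bigr => e _; rewrite /u andbT andbF.
  by case: ifP => _; ring.
move=> <-; apply: er_le => G GE; rewrite prod_cut_G // expr0n.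
rewrite /phi conn_inner //; case: (conn G A) => /=; last by rewrite mul0r.
by case: (_ == _); rewrite ?mulr0 // mulr1 ler_nat leq_b1.
Qed.

(** Chernoff's bound: the indicator of a boundary of at most eps |A| edges is at most exp(s (eps |A|
    - boundary)), and the boundary is a sum of |A| (N - |A|) Bernoulli variables, independent of one
    another and of the inner edges. *)
Let er_bad_cut_le A : (L <= #|A| <= M)%N ->
  er_expectation p (fun G => (bad_cut G A)%:R) <=
  expR (s * eps * #|A|%:R) * (Z p A * (1 - p * (1 - expR (- s))) ^+ (#|A| * (N - #|A|))).
Proof.
move=> LAM.
pose u (e : {set 'I_N}) b : R := if (e \in cut_edges A) && b then expR (- s) else 1.
have := @er_product R N p (inner_edges A) (fun H => (phi A H)%:R) u p01 (inner_edges_sub A).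
rewrite -/(Z p A).
have -> : \prod_(e in edges N :\: inner_edges A)
    (p * u e true + (1 - p) * u e false) = (1 - p * (1 - expR (- s))) ^+ (#|A| * (N - #|A|)).
  rewrite -prod_cut; apply: eq_bigr => e _; rewrite /u andbT andbF.
  by case: ifP => _; ring.
move=> <-; rewrite -er_scale; apply: er_le => G GE; rewrite prod_cut_G //.
case: (boolP (bad_cut G A)) => [/and4P[cA _ eA cutA]|_]; last first.
  by rewrite mulr_ge0 ?expR_ge0 // mulr_ge0 ?exprn_ge0 ?expR_ge0.
rewrite /phi conn_inner // cA eA mul1r -expRM_natl -expRD -[leLHS]expR0 ler_expR.
by rewrite mulrN subr_ge0 mulrC -[leRHS]mulrA ler_wpM2l.
Qed.

(* [1 - 1/N >= exp(- 1/(N - 1))], and the exponent [a (N - a)] is at most [a (N - 1)] *)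
Let one_sub_inv_exp A : (0 < #|A|)%N ->
  expR (- #|A|%:R) <= (1 - N%:R^-1 : R) ^+ (#|A| * (N - #|A|)).
Proof.
move=> A0; have [q0 q1] := andP q01.
have N1 : 1 < N%:R :> R by apply: lt_le_trans lamN.
have y0 : 0 < N%:R - 1 :> R by rewrite subr_gt0.
have e1 : expR (- (N%:R - 1)^-1) <= 1 - N%:R^-1 :> R.
  rewrite expRN -[leRHS]invrK lef_pV2 ?posrE ?invr_gt0 ?expR_gt0 //; last first.
    by rewrite subr_gt0 invf_lt1.
  apply: le_trans (expR_ge1Dx _); rewrite le_eqVlt; apply/orP; left; apply/eqP.
  by field; rewrite !gt_eqF.
have A1 : (1 <= #|A|)%N by [].
have AN : (#|A| <= N)%N by rewrite -[leqRHS]card_ord max_card.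
apply: le_trans (lerXn2r _ _ _ e1); rewrite ?nnegrE ?expR_ge0 ?subr_ge0 //.
rewrite -expRM_natl ler_expR mulrN lerN2 -[leRHS]mulr1 natrM -mulrA ler_wpM2l //.
by rewrite ler_pdivrMr // mul1r natrB // lerD2l lerN2 ler1n.
Qed.

(* Change of measure: a connected graph on A with fewer than |A| edges is at most lam ^ |A|
   times as likely under G(N, lam/N) as under G(N, 1/N), and under the latter it is a
   component with conditional probability at least exp(-|A|). *)
Let er_bad_cut_component A :
  er_expectation p (fun G => (bad_cut G A)%:R) <= expR (1 - gam * L%:R) *
  er_expectation N%:R^-1 (fun G => (conn G A && (edge_cut G A == 0%N))%:R).
Proof.
set P1 := er_expectation N%:R^-1 _.
have P1_ge0 : 0 <= P1 by rewrite -(er_const N 0 q01); apply: er_le.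
have [p0 p1] := andP p01.
have [LAM|LAM] := boolP (L <= #|A| <= M)%N; last first.
  apply: le_trans (_ : 0 <= _); last by rewrite mulr_ge0 ?expR_ge0.
  rewrite -(er_const N 0 p01); apply: er_le => G _.
  by rewrite /bad_cut (negPf LAM) andbF.
have [A0|A0] := posnP #|A|.
  apply: le_trans (_ : 0 <= _); last by rewrite mulr_ge0 ?expR_ge0.
  rewrite -(er_const N 0 p01); apply: er_le => G _.
  by rewrite /bad_cut /conn -cards_eq0 A0 eqxx.
have lam0 : 0 < lam by apply: lt_trans lam1.
have t01 : 0 <= 1 - expR (- s) <= 1.
  by rewrite subr_ge0 gerBl expR_ge0 andbT -expR0 ler_expR oppr_le0.
have [t0 t1] := andP t01; set t := 1 - expR (- s) in t0 t1.
have AN : (#|A| <= N)%N by rewrite -[leqRHS]card_ord max_card.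
set a := #|A| in LAM A0 AN.
have pt1 : p * t <= 1 by apply: mulr_ile1.
have Z1 : Z N%:R^-1 A <= expR a%:R * P1.
  have := er_component A; rewrite -/P1 -/a => h.
  rewrite -(ler_pM2l (expR_gt0 (- a%:R))) mulrA -expRD addNr expR0 mul1r.
  apply: le_trans h; rewrite mulrC ler_wpM2l ?Z_ge0 //; exact: one_sub_inv_exp.
(* The exponent - p t a (N - a) differs from - lam t a by lam t a^2 / N, which is at most 1 because
   a <= M and lam M^2 <= N. *)
have cut_exp : (1 - p * t) ^+ (a * (N - a)) <= expR (1 - lam * t * a%:R).
  apply: (@le_trans _ _ (expR (- (p * t)) ^+ (a * (N - a)))).
    by rewrite lerXn2r ?nnegrE ?expR_ge0 ?subr_ge0 // expR_ge1Dx.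
  rewrite -expRM_natl ler_expR natrM natrB //.
  have -> : a%:R * (N%:R - a%:R) * - (p * t) =
     (lam * a%:R ^+ 2) / N%:R * t - lam * t * a%:R :> R by field; rewrite gt_eqF.
  rewrite lerD2r; apply: mulr_ile1 => //.
    by rewrite divr_ge0 // mulr_ge0 ?sqr_ge0 // ltW.
  rewrite ler_pdivrMr // mul1r; apply: le_trans NM; apply: ler_wpM2l; first exact: ltW.
  by rewrite lerXn2r ?nnegrE // ler_nat; case/andP: LAM.
apply: le_trans (er_bad_cut_le LAM) _; rewrite -/t -/a.
have h1 : Z p A <= expR (ln lam * a%:R) * (expR a%:R * P1).
  apply: le_trans (Z_le A) _; rewrite -/a; apply: ler_pM => //.
  - by rewrite exprn_ge0 // ltW.
  - exact: Z_ge0.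
  - by rewrite mulrC expRM_natl lnK.
apply: (@le_trans _ _ (expR (s * eps * a%:R) *
   (expR (ln lam * a%:R) * (expR a%:R * P1) * expR (1 - lam * t * a%:R)))).
  by rewrite ler_wpM2l ?expR_ge0 // ler_pM ?Z_ge0 // exprn_ge0 // subr_ge0.
(* The rate per vertex collects ln lam from the change of measure, 1 from the isolation of A in the
   critical graph, and s eps - lam t from Chernoff's bound. *)
have -> : expR (s * eps * a%:R) *
   (expR (ln lam * a%:R) * (expR a%:R * P1) * expR (1 - lam * t * a%:R)) =
   expR (1 + (ln lam + 1 + s * eps - lam * t) * a%:R) * P1.
  rewrite (_ : 1 + _ = s * eps * a%:R + (ln lam * a%:R + (a%:R + (1 - lam * t * a%:R)))); last by ring.
  by rewrite !expRD; ring.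
rewrite ler_wpM2r // ler_expR lerD2l.
apply: (@le_trans _ _ (- gam * a%:R)); first by rewrite ler_wpM2r.
by rewrite mulNr lerN2 ler_wpM2l // ler_nat; case/andP: LAM.
Qed.

(** Weighted by |A|, the components of the critical graph add up to at most N. *)
Lemma er_bad_cut : er_expectation p
    (fun G => (\sum_(A : {set 'I_N}) #|A| * bad_cut G A)%:R) <=
  expR (1 - gam * L%:R) * N%:R.
Proof.
apply: (@le_trans _ _ (\sum_(A : {set 'I_N}) #|A|%:R * (expR (1 - gam * L%:R) *
  er_expectation N%:R^-1 (fun G => (conn G A && (edge_cut G A == 0%N))%:R)))).
  apply: (@le_trans _ _ (\sum_(A : {set 'I_N}) #|A|%:R * er_expectation p (fun G => (bad_cut G A)%:R))).
    under [X in _ <= X]eq_bigr do rewrite -er_scale.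
    by rewrite -er_sum; apply: er_le => G _; rewrite natr_sum ler_sum // => A _; rewrite natrM.
  by apply: ler_sum => A _; rewrite ler_wpM2l // er_bad_cut_component.
under eq_bigr do rewrite mulrCA -er_scale.
rewrite -mulr_sumr -er_sum ler_wpM2l ?expR_ge0 //.
rewrite -[leRHS](er_const N _ q01); apply: er_le => G _.
apply: le_trans (_ : (\sum_(A : {set 'I_N} | conn G A && (edge_cut G A == 0%N)) #|A|)%:R <= _).
  rewrite natr_sum [leRHS]big_mkcond; apply: ler_sum => A _.
  by case: ifP => _; rewrite ?mulr1 ?mulr0.
by rewrite ler_nat sum_components.
Qed.

Lemma er_card_bad_set : er_expectation p (fun G => #|bad_set G|%:R) <=
  N%:R * (lam / D.+1%:R) + ((M * 2 ^ (2 ^ M))%:R * (M.+1%:R * lam ^+ M) +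
  expR (1 - gam * L%:R) * N%:R).
Proof.
apply: le_trans (lerD er_degree (lerD er_bad_cycle er_bad_cut)).
rewrite -!er_add; apply: er_le => G _; rewrite -!natrD ler_nat.
exact: card_bad_set.
Qed.

End BadSet.

(** * The upper bound on N vertices *)

Section Upper.
Variable R : realType.

Lemma dos_N_le (lam : R) N (B : set R) (c : R) : (0 < N)%N ->
  er_expectation (lam / N%:R)
    (fun G : {set {set 'I_N}} => (eig_count (laplacian R G) B)%:R) <= c * N%:R ->
  (dos_N lam N B <= c%:E)%E.
Proof.
move=> N0 h; rewrite /dos_N lee_fin ler_pdivrMl ?ltr0n //.
by rewrite [leRHS]mulrC.
Qed.

Lemma exists_Chernoff_constants (lam : R) : 1 < lam -> exists s eps gam : R,
  [/\ 0 <= s, 0 < eps, 0 < gam &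
   ln lam + 1 + s * eps - lam * (1 - expR (- s)) <= - gam].
Proof.
move=> lam1; have lam0 : 0 < lam by apply: lt_trans lam1.
pose k := lam - 1 - ln lam.
have k0 : 0 < k.
  have := @expR_gt1Dx _ (ln lam); rewrite lnK // => /(_ _).
  by rewrite /k => h; rewrite subr_gt0 ltrBrDl h // gt_eqF // ln_gt0.
have k4 : 1 < 4 * lam / k.
  rewrite ltr_pdivlMr // mul1r /k; have : 0 < ln lam by rewrite ln_gt0.
  lra.
have s0 : 0 < ln (4 * lam / k) by rewrite ln_gt0.
(* The rate without Chernoff losses is -k, and k > 0 because ln lam < lam - 1. Here s makes lam
   exp(-s) = k / 4 and eps makes s eps = k / 4, which leaves -k / 2. *)
exists (ln (4 * lam / k)), (k / (4 * ln (4 * lam / k))), (k / 2); split.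
- exact: ltW.
- by rewrite divr_gt0 // mulr_gt0.
- by rewrite divr_gt0.
rewrite expRN lnK ?posrE ?(lt_trans _ k4) //.
set s := ln (4 * _ / _) in s0 *.
have -> : s * (k / (4 * s)) = k / 4 by field; rewrite gt_eqF.
have -> : lam * (1 - (4 * lam / k)^-1) = lam - k / 4.
  by field; rewrite !gt_eqF.
by rewrite /k; lra.
Qed.

Lemma pow_small (y c : R) : 0 < y -> y <= 1 -> exists j : nat, (1 - y) ^+ (2 ^ j.+1) <= expR (- c).
Proof.
move=> y0 y1; exists (Num.truncn (c / y)).
set j := Num.truncn _.
apply: (@le_trans _ _ (expR (- y) ^+ (2 ^ j.+1))).
  by rewrite lerXn2r ?nnegrE ?expR_ge0 ?subr_ge0 // expR_ge1Dx.
rewrite -expRM_natl ler_expR mulrN lerN2 -ler_pdivrMr //.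
apply: (@le_trans _ _ j.+1%:R); first by apply: ltW; exact: truncnS_gt.
by rewrite ler_nat ltnW // ltn_expl.
Qed.

Lemma dos_N_upper (lam : R) : 1 < lam -> exists (gam K1 : R) (L0 : nat),
  [/\ 0 < gam, 0 < K1 & forall L (E : R), (L0 <= L)%N -> 0 < E ->
    8 * (3 * L + 1)%:R ^+ 2 * E <= 1 ->
    exists N0, forall N, (N0 <= N)%N ->
      (dos_N lam N `]0%R, E[%classic <= (K1 * expR (- (gam * L%:R)))%:E)%E].
Proof.
move=> lam1; have [s [eps [gam [s0 eps0 gam0 gamE]]]] := exists_Chernoff_constants lam1.
(* With x = exp(- gam L), the large degrees, the cycles and the trace of T contribute x each, and
   the bad cuts e x. The lower bound on L yields eps L >= 1. *)
exists gam, (3 + expR 1), (Num.truncn eps^-1).+1; split => //.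
move=> L E L0L E0 EL; have lam0 : 0 < lam by apply: lt_trans lam1.
have L0 : (0 < L)%N by apply: leq_trans L0L.
have epsL : 1 <= eps * L%:R.
  rewrite -ler_pdivrMl // mulr1; apply: (@le_trans _ _ (Num.truncn eps^-1).+1%:R).
    by apply: ltW; exact: truncnS_gt.
  by rewrite ler_nat.
set x := expR (- (gam * L%:R)); have x0 : 0 < x by exact: expR_gt0.
(* The parameters are chosen in turn: D from L, so that large degrees are rare; j from D and E, so
   that the trace is small; M from D and j, so that the iterates fit; and N last, so that the cycle
   bound [c] is at most N x. *)
pose D := (Num.truncn (lam / x)).+1.
have Dx : lam / D.+1%:R <= x.
  rewrite ler_pdivrMr // mulrC -ler_pdivrMr //; apply: ltW.
  apply: lt_le_trans (truncnS_gt _) _; by rewrite ler_nat.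
have E1 : E <= 1.
  have k1 : 1 <= (3 * L + 1)%:R ^+ 2 :> R by rewrite exprn_ege1 // ler1n addn1.
  have := ler_wpM2r (ltW E0) k1; move: EL; lra.
have y0 : 0 < (2 * D)%:R^-1 * E by rewrite mulr_gt0 // invr_gt0 ltr0n.
have y1 : (2 * D)%:R^-1 * E <= 1.
  by rewrite ler_pdivrMl ?ltr0n // mulr1 (le_trans E1) // ler1n.
have [j jx] := pow_small (gam * L%:R) y0 y1; rewrite -/x in jx.
pose M := maxn L (D.+1 ^ (2 ^ j)).
pose c := (M * 2 ^ (2 ^ M))%:R * (M.+1%:R * lam ^+ M).
exists (Num.truncn (c / x) + Num.truncn (lam * M%:R ^+ 2) + Num.truncn lam).+1 => N NN.
have big (z : R) : (Num.truncn z < N)%N -> z <= N%:R.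
  move=> zN; apply: (@le_trans _ _ (Num.truncn z).+1%:R); last by rewrite ler_nat.
  by apply: ltW; exact: truncnS_gt.
have cN : c / x <= N%:R.
  by apply: big; apply: leq_trans NN; rewrite ltnS -addnA leq_addr.
have MN : lam * M%:R ^+ 2 <= N%:R.
  by apply: big; apply: leq_trans NN; rewrite ltnS addnAC leq_addl.
have lamN : lam <= N%:R.
  by apply: big; apply: leq_trans NN; rewrite ltnS leq_addl.
have N0 : (0 < N)%N by apply: leq_trans NN.
have p01 : 0 <= lam / N%:R <= 1.
  by rewrite divr_ge0 ?ler_pdivrMr ?mul1r ?ltr0n // ltW.
apply: dos_N_le => //.
apply: (@le_trans _ _ (er_expectation (lam / N%:R) (fun G : {set {set 'I_N}} =>
   #|bad_set L D M eps G|%:R + N%:R * (1 - (2 * D)%:R^-1 * E) ^+ (2 ^ j.+1)))).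
  apply: er_le => G GE; apply: (@eig_count_le R N G GE L D M j eps E) => //.
  - exact: leq_maxl.
  - exact: leq_maxr.
  - move=> A cA AM cyc; apply/fintype.subsetP => i iA; rewrite inE; apply/or3P/Or32.
    by apply/existsP; exists A; rewrite iA /bad_cycle cA AM cyc.
  - move=> A cA AM cyc cutA; apply/fintype.subsetP => i iA; rewrite inE; apply/or3P/Or33.
    by apply/existsP; exists A; rewrite iA /bad_cut cA AM cyc cutA.
  - by move=> i; rewrite inE !negb_or -leqNgt => /and3P[].
rewrite er_add er_const //.
apply: (le_trans (lerD (er_card_bad_set lam1 lamN L D s0 (ltW gam0) MN gamE) (lexx _))).
rewrite -/c expRD -/x.
have n0 : 0 < N%:R :> R by rewrite ltr0n.
have h1 := ler_wpM2l (ltW n0) Dx; have h2 := ler_wpM2l (ltW n0) jx.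
have h3 : c <= N%:R * x by rewrite -ler_pdivrMr.
move: h1 h2 h3; set u := N%:R * (lam / _); set v := N%:R * (_ ^+ _); set e := expR 1.
have -> : (3 + e) * x * N%:R = 3 * (N%:R * x) + e * x * N%:R by ring.
lra.
Qed.

End Upper.

(** * Path components *)

Section Paths.
Variables (R : realType) (N m : nat).
Local Notation L := m.+1.
Implicit Types (G : {set {set 'I_N}}) (t : {ffun 'I_L -> 'I_N}).

Definition consecutive (i j : nat) : bool := (j == i.+1) || (i == j.+1).

(** The neighbours of each t i in the whole graph are prescribed, so the image of t induces a path
    and no edge leaves it. A path with at least two vertices is enumerated twice, once from each
    end. *)
Definition path_component G t : bool := injectiveb t &&
  [forall i, [forall x, adj G (t i) x == [exists j, (t j == x) && consecutive i j]]].

Lemma path_componentP G t : path_component G t -> injective t /\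
  (forall i x, adj G (t i) x = [exists j, (t j == x) && consecutive i j]).
Proof.
case/andP => /injectiveP inj /forallP H; split=> // i x.
by have /forallP/(_ x)/eqP := H i.
Qed.

Lemma path_component_adj G t i j : path_component G t -> adj G (t i) (t j) = consecutive i j.
Proof.
case/path_componentP => inj ->; apply/existsP/idP => [[k /andP[/eqP/inj -> //]]|ij].
by exists j; rewrite eqxx.
Qed.

(** The enumeration starts at an end of the path, so each next vertex is forced: it is the neighbour
    not yet visited. Path components are thus indexed by their first vertices. *)
Lemma path_component_unique G t t' : path_component G t -> path_component G t' ->
  t ord0 = t' ord0 -> t = t'.
Proof.
move=> pt pt' t0; have [inj H] := path_componentP pt; have [inj' H'] := path_componentP pt'.
have E k : (k < L)%N -> forall j, (j <= k)%N -> t (inord j) = t' (inord j).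
  elim: k => [|k IH] kL j jk.
    move: jk; rewrite leqn0 => /eqP ->.
    by rewrite (_ : inord 0 = ord0) //; apply/val_inj; rewrite /= inordK.
  move: jk; rewrite leq_eqVlt ltnS => /orP[/eqP ->|]; last by apply: IH; apply: ltnW.
  have : adj G (t (inord k)) (t (inord k.+1)).
    by rewrite path_component_adj // !inordK ?(ltnW kL) // /consecutive eqxx.
  rewrite (IH (ltnW kL)) // H' => /existsP[l /andP[/eqP tl]].
  rewrite /consecutive inordK ?(ltnW kL) // => /orP[/eqP lk|/eqP kl].
    by rewrite -tl; congr (t' _); apply/val_inj; rewrite /= inordK.
  have : t (inord l) = t (inord k.+1).
    by rewrite (IH (ltnW kL)) ?inord_val // kl leqnSn.
  move=> /inj/(congr1 val); rewrite /= !inordK // => lk.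
  by move: kl; rewrite lk => /eqP; rewrite ltn_eqF // ltnS leqnSn.
by apply/ffunP => i; rewrite -[i]inord_val; apply: (E i).
Qed.

Let theta : R := pi / (2 * L)%:R.
(** The discrete Neumann eigenfunction cos((k + 1/2) pi / L) of the path. *)
Let c (k : nat) : R := cos ((2 * k + 1)%:R * theta).
Definition path_eigenvalue : R := 2 - 2 * cos (pi / L%:R).

Let thetaE : pi / L%:R = 2 * theta.
Proof. by rewrite /theta natrM invfM mulrCA mulVKf. Qed.

Let c_rec k : c k + c k.+2 = 2 * cos (pi / L%:R) * c k.+1.
Proof.
rewrite thetaE /c.
have -> : (2 * k + 1)%:R * theta = (2 * k.+1 + 1)%:R * theta - 2 * theta.
  by rewrite !natrD !natrM -[k.+1%:R]natr1; ring.
have -> : (2 * k.+2 + 1)%:R * theta = (2 * k.+1 + 1)%:R * theta + 2 * theta.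
  by rewrite !natrD !natrM -[k.+2%:R]natr1; ring.
by rewrite cosB cosD; ring.
Qed.

(** The recurrence at the end 0, with the reflected value c(-1) = c(0); [c_end] is the reflection at
    the other end. *)
Let c_start : c 0 + c 1 = 2 * cos (pi / L%:R) * c 0.
Proof.
rewrite thetaE /c muln0 muln1 !mul1r.
have -> : (2 + 1)%:R * theta = theta + 2 * theta by rewrite natrD; ring.
have {1}-> : theta = 2 * theta - theta by ring.
rewrite cosB cosD; ring.
Qed.

Let c_end : c L = c m.
Proof.
have e : L%:R * 2 * theta = pi by rewrite -mulrA -thetaE mulrC divfK ?pnatr_eq0.
rewrite /c.
have -> : (2 * L + 1)%:R * theta = theta + pi by rewrite natrD natrM -e; ring.
have -> : (2 * m + 1)%:R * theta = - theta + pi by rewrite -e natrD natrM -[L%:R]natr1; ring.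
by rewrite !cosDpi cosN.
Qed.

(** By reflection a missing neighbour would contribute the difference 0, so the recurrence holds at
    both ends as well. *)
Let sum_consecutive (i : 'I_L) :
  \sum_(j < L) (consecutive i j)%:R * (c i - c j) = path_eigenvalue * c i.
Proof.
have S1 : \sum_(j < L) (j == i.+1 :> nat)%:R * (c i - c j) = c i - c i.+1.
  have [iL|] := ltnP i.+1 L.
    rewrite (bigD1 (Ordinal iL)) //= eqxx mul1r big1 ?addr0 // => j /negPf ji.
    by rewrite -val_eqE /= in ji; rewrite ji mul0r.
  move=> mi; have im : i = m :> nat by apply/eqP; rewrite eqn_leq -ltnS ltn_ord.
  rewrite im c_end subrr big1 // => j _.
  by rewrite ltn_eqF ?mul0r // im.
have S2 k : (k < L)%N -> \sum_(j < L) (k == j.+1 :> nat)%:R * (c k - c j) =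
    if k is k'.+1 then c k - c k' else 0.
  case: k => [|k] kL; first by rewrite big1 // => j _; rewrite mul0r.
  rewrite (bigD1 (Ordinal (ltnW kL))) //= eqxx mul1r big1 ?addr0 // => j /negPf ji.
  by rewrite -val_eqE /= in ji; rewrite eqSS eq_sym ji mul0r.
rewrite (eq_bigr (fun j : 'I_L => (j == i.+1 :> nat)%:R * (c i - c j) +
   (i == j.+1 :> nat)%:R * (c i - c j))); last first.
  move=> j _; rewrite -mulrDl /consecutive; congr (_ * _).
  case: eqP => [->|_]; last by rewrite add0r.
  by rewrite ltn_eqF ?addr0 // ltnS leqnSn.
rewrite big_split /= S1 (S2 _ (ltn_ord i)) /path_eigenvalue mulrBl.
case: (i : nat) => [|k]; first by rewrite -c_start; ring.
by rewrite -c_rec; ring.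
Qed.

Let v t : 'rV[R]_N := \row_x \sum_i (t i == x)%:R * c i.

Let v_t t i : injective t -> v t 0 (t i) = c i.
Proof.
move=> inj; rewrite mxE (bigD1 i) //= eqxx mul1r big1 ?addr0 // => j ji.
by rewrite (inj_eq inj) (negPf ji) mul0r.
Qed.

Let sum_codom t (f : 'I_N -> R) : injective t ->
  (forall y, (forall j, t j != y) -> f y = 0) -> \sum_y f y = \sum_j f (t j).
Proof.
move=> inj f0; rewrite (bigID (mem (codom t))) /= [X in _ + X]big1 ?addr0; last first.
  by move=> y yt; apply: f0 => j; apply: contra yt => /eqP <-; exact: codom_f.
transitivity (\sum_(y <- codom t) f y); last by rewrite big_image.
by rewrite big_uniq //=; apply/injectiveP.
Qed.

Let path_eigenvector G t : path_component G t ->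
  v t *m laplacian R G = path_eigenvalue *: v t.
Proof.
move=> pt; have [inj H] := path_componentP pt.
apply/rowP => x; rewrite lap_entry [RHS]mxE.
have [/codomP[i ->]|xt] := boolP (x \in codom t).
  rewrite (sum_codom inj) => [|y yt]; last first.
    rewrite H; case: existsP => [[j /andP[/eqP jy]]|_]; last by rewrite mul0r.
    by move: (yt j); rewrite jy eqxx.
  rewrite v_t // -sum_consecutive; apply: eq_bigr => j _.
  by rewrite path_component_adj // v_t.
have vx : v t 0 x = 0.
  rewrite mxE big1 // => j _; case: eqP => [jx|_]; last by rewrite mul0r.
  by move: xt; rewrite -jx codom_f.
rewrite vx mulr0 big1 // => y _.
have [/codomP[i ->]|yt] := boolP (y \in codom t).
  rewrite adjC H; case: existsP => [[j /andP[/eqP jx]]|_]; last by rewrite mul0r.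
  by move: xt; rewrite -jx codom_f.
rewrite [v t 0 y]mxE [X in _ - X]big1 ?subrr ?mulr0 // => j _; case: eqP => [jx|_]; last by rewrite mul0r.
by move: yt; rewrite -jx codom_f.
Qed.

Hypothesis m0 : (0 < m)%N.

(** The square is (1 + cos(pi / L)) / 2, and pi / L <= pi / 2 since m > 0. *)
Let c0_sqr : 2^-1 <= c 0 ^+ 2.
Proof.
have h : 0 <= cos (pi / L%:R) :> R.
  apply: cos_ge0_pihalf; apply/andP; split.
    by rewrite (@le_trans _ _ 0) ?oppr_le0 ?divr_ge0 // ?pi_ge0 // ltW // pi_gt0.
  by rewrite ler_wpM2l ?pi_ge0 // lef_pV2 ?posrE // ler_nat.
move: h; rewrite thetaE mulr_natl cos_mulr2n /c muln0 add0n mul1r.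
rewrite -[cos theta ^+ 2 *+ 2]mulr_natl; lra.
Qed.

Definition path_components G := [set t : {ffun 'I_L -> 'I_N} | path_component G t]%SET.

(** The eigenvector of a path component has square at least 1/2 at the first vertex and squared norm
    at most L. First vertices being distinct, [rank_ge_card] applies with c = 1 / (2 L). *)
Lemma card_path_components_le G :
  #|path_components G|%:R * (2 * L)%:R^-1 <=
  (eig_count (laplacian R G) [set path_eigenvalue])%:R :> R.
Proof.
pose P := path_components G; pose X := [set (t : {ffun 'I_L -> 'I_N}) ord0 | t in P]%SET.
have <- : #|X| = #|P|.
  apply: card_in_imset => t t'; rewrite !inE; exact: path_component_unique.
rewrite /eig_count fsbig_set1; apply: rank_ge_card => x /imsetP[t]; rewrite inE => pt ->.
have [inj _] := path_componentP pt.
have dotE : dot (v t) (v t) = \sum_(j < L) c j ^+ 2.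
  rewrite /dot (sum_codom inj) => [|y yt].
    by apply: eq_bigr => j _; rewrite v_t.
  by rewrite mxE big1 ?mul0r // => j _; rewrite (negPf (yt j)) mul0r.
exists (v t); split; first exact/eigenspaceP/path_eigenvector.
  rewrite dotE big_ord_recl; apply: (@lt_le_trans _ _ 2^-1) => //.
  by apply: (le_trans c0_sqr); rewrite lerDl sumr_ge0 // => j _; rewrite sqr_ge0.
rewrite v_t //; apply: le_trans c0_sqr.
rewrite natrM invfM -mulrA ler_piMr // ler_pdivrMl // mulr1 dotE.
rewrite -[leRHS]mul1r mulr_natr -[X in _ *+ X]card_ord -sumr_const; apply: ler_sum => j _.
by rewrite -[leRHS](expr1n _ 2) -real_normK ?num_real // lerXn2r ?nnegrE // ler_norml cos_geN1 cos_le1.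
Qed.

Let path_edges t : {set {set 'I_N}} :=
  [set [set t (widen_ord (leqnSn m) i); t (lift ord0 i)]%SET | i in 'I_m]%SET.

Let touching_edges t : {set {set 'I_N}} :=
  [set e in edges N | [exists i, t i \in e]]%SET.

Let card_path_edges t : (#|path_edges t| <= m)%N.
Proof. by rewrite -[leqRHS]card_ord leq_imset_card. Qed.

Let path_edgesP t (i j : 'I_L) : consecutive i j -> [set t i; t j]%SET \in path_edges t.
Proof.
have H (k l : 'I_L) : l = k.+1 :> nat -> [set t k; t l]%SET \in path_edges t.
  move=> lk; have km : (k < m)%N by rewrite -ltnS -lk ltn_ord.
  have <- : widen_ord (leqnSn m) (Ordinal km) = k by exact/val_inj.
  have <- : lift ord0 (Ordinal km) = l by apply/val_inj; exact: (etrans (lift0 _) (esym lk)).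
  exact: imset_f.
by case/orP => /eqP ij; [exact: H|rewrite finset.setUC; exact: H].
Qed.

Let widen_neq_lift (i : 'I_m) : widen_ord (leqnSn m) i != lift ord0 i.
Proof.
apply/eqP => /(congr1 (@nat_of_ord _)); rewrite lift0 /= => /eqP.
by rewrite ltn_eqF.
Qed.

Let path_edges_sub t : injective t -> path_edges t \subset edges N.
Proof.
move=> inj; apply/fintype.subsetP => e /imsetP[i _ ->]; rewrite inE cards2 (inj_eq inj).
by rewrite widen_neq_lift.
Qed.

Let card_touching_edges t : (#|touching_edges t| <= L * N)%N.
Proof.
apply: (@leq_trans #|[set [set t iy.1; iy.2]%SET | iy : 'I_L * 'I_N]%SET|).
  apply: subset_leq_card; apply/fintype.subsetP => e; rewrite inE => /andP[eE /existsP[i ti]].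
  have [x [y [xy exy]]] := edgeP eE.
  move: ti; rewrite exy !inE => /orP[/eqP <-|/eqP <-].
    by apply/imsetP; exists (i, y).
  by rewrite finset.setUC; apply/imsetP; exists (i, x).
by rewrite (leq_trans (leq_imset_card _ _)) // card_prod !card_ord.
Qed.

(** It suffices that the path edges are present and that all other edges touching the path are
    absent; there are at most m and L N of them. *)
Lemma er_path_component (p : R) t : 0 <= p <= 1 -> injective t ->
  p ^+ m * (1 - p) ^+ (L * N) <= er_expectation p (fun G => (path_component G t)%:R).
Proof.
move=> p01 inj; have [p0 p1] := andP p01.
have q0 : 0 <= 1 - p by rewrite subr_ge0.
have q1 : 1 - p <= 1 by rewrite gerBl.
pose u (e : {set 'I_N}) (b : bool) : R := if e \in path_edges t then b%:R
  else if e \in touching_edges t then (~~ b)%:R else 1.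
apply: (@le_trans _ _ (er_expectation p (fun G => \prod_(e in edges N) u e (e \in G)))).
  rewrite er_prod //.
  apply: (@le_trans _ _ (\prod_(e in edges N) ((if e \in path_edges t then p else 1) *
     (if e \in touching_edges t then 1 - p else 1)))).
    rewrite big_split /= -!big_mkcondr /= ler_pM ?exprn_ge0 //.
      rewrite (eq_bigl (fun e => e \in path_edges t)) => [|e]; last first.
        by rewrite andbC; case eP: (e \in path_edges t) => //=; exact: (fintype.subsetP (path_edges_sub inj)).
      by rewrite prodr_const ler_wiXn2l.
    rewrite (eq_bigl (fun e => e \in touching_edges t)) => [|e]; last first.
      by rewrite /touching_edges !inE andbA andbb.
    by rewrite prodr_const ler_wiXn2l.
  apply: ler_prod => e _; apply/andP; split.
    by apply: mulr_ge0; case: ifP.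
  rewrite /u; case: ifP => _ /=.
    by rewrite mulr1 mulr0 addr0 ler_piMr //; case: ifP.
  rewrite mul1r; case: ifP => _ /=; first by rewrite mulr0 add0r mulr1.
  by rewrite !mulr1 addrC subrK.
apply: er_le => G GE.
have [->|/prodf_neq0 nz] := eqVneq (\prod_(e in edges N) u e (e \in G)) 0; first by [].
have pathG e : e \in path_edges t -> e \in G.
  move=> eP; have := nz e (fintype.subsetP (path_edges_sub inj) _ eP).
  by rewrite /u eP; case: (e \in G); rewrite ?eqxx.
have touchG e : e \in touching_edges t -> e \in G -> e \in path_edges t.
  move=> eT eG; have := nz e (fintype.subsetP GE _ eG).
  by rewrite /u eT eG; case: ifP; rewrite // eqxx.
suff -> : path_component G t.
  apply: (@le_trans _ _ (\prod_(e in edges N) 1)); last by rewrite big1.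
  by apply: ler_prod => e _; rewrite /u; case: ifP => _; [|case: ifP => _]; case: (e \in G); rewrite /= ?ler01 ?lexx.
apply/andP; split; first exact/injectiveP.
apply/forallP => i; apply/forallP => x; apply/eqP.
apply/idP/existsP => [ix|[j /andP[/eqP <- ij]]]; last exact/pathG/path_edgesP.
have : [set t i; x]%SET \in path_edges t.
  apply: (touchG _ _ ix); rewrite inE (fintype.subsetP GE _ ix) /=.
  by apply/existsP; exists i; rewrite set21.
case/imsetP => k _ /eqP; rewrite eq_set2; last first.
  by rewrite (inj_eq inj) widen_neq_lift.
case/orP => /andP[/eqP/inj -> /eqP ->].
  by exists (lift ord0 k); rewrite eqxx /consecutive lift0 eqxx.
by exists (widen_ord (leqnSn m) k); rewrite eqxx /consecutive lift0 eqxx orbT.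
Qed.

Lemma er_eig_count_ge (p : R) : 0 <= p <= 1 ->
  (N ^_ L)%:R * (p ^+ m * (1 - p) ^+ (L * N)) * (2 * L)%:R^-1 <=
  er_expectation p (fun G => (eig_count (laplacian R G) [set path_eigenvalue])%:R).
Proof.
move=> p01; apply: (@le_trans _ _ (er_expectation p (fun G => (2 * L)%:R^-1 *
    \sum_(t : {ffun 'I_L -> 'I_N}) (path_component G t)%:R))); last first.
  apply: er_le => G _; rewrite mulrC; apply: le_trans (card_path_components_le G).
  rewrite ler_wpM2r // -natr_sum ler_nat -sum1_card [X in (_ <= X)%N]big_mkcond /=.
  by apply: leq_sum => t _; rewrite inE; case: (path_component G t).
rewrite er_scale er_sum mulrC ler_wpM2l //.
have -> : (N ^_ L)%N = #|[set t : {ffun 'I_L -> 'I_N} | injectiveb t]%SET|.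
  by have := card_inj_ffuns 'I_L 'I_N; rewrite !card_ord => <-; apply: eq_card => t; rewrite !inE.
rewrite mulr_natl -sumr_const big_mkcond; apply: ler_sum => t _.
case: ifP => [|_]; first by rewrite inE => /injectiveP inj; exact: er_path_component.
by rewrite -(er_const N 0 p01); apply: er_le.
Qed.

End Paths.

(** * The lower bound on N vertices *)

Section Lower.
Variable R : realType.

Lemma ffact_ge n m : ((n - m) ^ m <= n ^_ m)%N.
Proof.
have H k : (k <= m)%N -> ((n - m) ^ k <= n ^_ k)%N.
  elim: k => [|k IH] km; first by rewrite expn0 ffactn0.
  by rewrite expnSr ffactnSr leq_mul ?IH ?(ltnW km) // leq_sub2l // ltnW.
exact: H.
Qed.

Lemma dos_N_lower (lam : R) m : 1 < lam -> (0 < m)%N ->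
  exists N0, forall N, (N0 <= N)%N ->
    ((expR (- ((2 + 2 * lam) * m.+1%:R)))%:E <= dos_N lam N [set path_eigenvalue R m])%E.
Proof.
move=> lam1 m0; have lam0 : 0 < lam by apply: lt_trans lam1.
(* With L = m + 1, this makes p <= 1/2, so that (1 - p)^(L N) >= exp(-2 lam L), and L <= N / 2, so
   that the number of injections times p^m is at least N 2^(-L). Finally 2^(-L) / (2 L) >= exp(-2
   L), which explains the rate 2 + 2 lam. *)
exists ((Num.truncn (2 * lam)).+1 + 2 * m.+1)%N => N NN; rewrite /dos_N lee_fin.
have N0 : (0 < N)%N by apply: leq_trans NN; rewrite addn_gt0.
have n0 : 0 < N%:R :> R by rewrite ltr0n.
have lamN : 2 * lam <= N%:R.
  apply: ltW; apply: lt_le_trans (truncnS_gt _) _; rewrite ler_nat.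
  by apply: leq_trans NN; rewrite leq_addr.
have NL : (2 * m.+1 <= N)%N by apply: leq_trans NN; rewrite leq_addl.
set p := lam / N%:R.
have p0 : 0 <= p by rewrite divr_ge0 // ltW.
have p2 : p <= 2^-1 by rewrite ler_pdivrMr // mulrC ler_pdivlMr // mulrC.
have p01 : 0 <= p <= 1 by rewrite p0; lra.
have pN : p * N%:R = lam by rewrite divfK // gt_eqF.
rewrite ler_pdivlMl //.
apply: le_trans (er_eig_count_ge N m0 p01).
rewrite ler_pdivlMr ?ltr0n //.
have q0 : 0 < 1 - p by lra.
have h1 : expR (- (2 * lam * m.+1%:R)) <= (1 - p) ^+ (m.+1 * N).
  have h : expR (- (2 * p)) <= 1 - p.
    rewrite expRN invf_ple ?posrE ?expR_gt0 //.
    apply: le_trans (expR_ge1Dx _); rewrite -[leLHS]mul1r ler_pdivrMr //.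
    by move: p0 p2; clear; nra.
  apply: (@le_trans _ _ (expR (- (2 * p)) ^+ (m.+1 * N))).
    by rewrite -expRM_natl ler_expR natrM -pN; lra.
  by rewrite lerXn2r ?nnegrE ?expR_ge0 // ltW.
have h2 : N%:R * 2^-1 ^+ m.+1 <= (N ^_ m.+1)%:R * p ^+ m.
  apply: (@le_trans _ _ ((N%:R / 2) ^+ m.+1 * p ^+ m)).
    have -> : (N%:R / 2) ^+ m.+1 * p ^+ m = N%:R * 2^-1 ^+ m.+1 * lam ^+ m.
      by rewrite -pN exprMn exprS [(_ * N%:R) ^+ m]exprMn; ring.
    by rewrite ler_peMr ?mulr_ge0 ?exprn_ge0 // exprn_ege1 // ltW.
  rewrite ler_wpM2r ?exprn_ge0 //.
  apply: (@le_trans _ _ ((N - m.+1) ^ m.+1)%:R); last by rewrite ler_nat ffact_ge.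
  have mN : (m.+1 <= N)%N by apply: leq_trans NL; rewrite leq_pmull.
  have : (2 * m.+1)%:R <= N%:R :> R by rewrite ler_nat.
  rewrite natrX natrM => h; rewrite lerXn2r ?nnegrE ?divr_ge0 // natrB //; lra.
have h3 : expR (- (2 * m.+1%:R)) * (2 * m.+1)%:R <= 2^-1 ^+ m.+1 :> R.
  rewrite expRN exprVn ler_pdivrMl ?expR_gt0 // ler_pdivlMr ?exprn_gt0 //.
  have e2 : 2 <= expR 1 :> R by have := expR_ge1Dx (1 : R); lra.
  have -> : 2 * m.+1%:R = (m.+1 * 2)%:R * 1 :> R by rewrite natrM mulr1 mulrC.
  rewrite expRM_natl exprM.
  apply: (@le_trans _ _ ((2 ^+ m.+1) ^+ 2)); last first.
    by rewrite lerXn2r ?nnegrE ?exprn_ge0 ?expR_ge0 // lerXn2r ?nnegrE ?expR_ge0.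
  rewrite expr2 ler_wpM2r ?exprn_ge0 // -natrX ler_nat expnS leq_mul2l /=.
  exact: ltn_expl.
rewrite mulrDl opprD expRD.
set x := expR (- (2 * m.+1%:R)) in h3 *; set y := expR _ in h1 *.
set z := _ ^+ (_ * _) in h1 *; set w := _%:R * p ^+ m in h2.
have y0 : 0 <= y by exact: expR_ge0.
have -> : N%:R * (x * y) * (2 * m.+1)%:R = N%:R * (x * (2 * m.+1)%:R) * y by ring.
apply: (@le_trans _ _ (N%:R * 2^-1 ^+ m.+1 * y)).
  by rewrite ler_wpM2r // ler_wpM2l // ltW.
by rewrite mulrA -/w; apply: ler_pM.
Qed.

End Lower.

(** * The weak limit *)

Section WeakLimit.
Variable R : realType.
Local Notation T := (measurableTypeR R).
Variables (mu_ : nat -> {measure set T -> \bar R}) (mu : {measure set T -> \bar R}).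
Hypothesis mu_cvg : cvg_weakly mu_ mu.

(** A continuous trapezoid between the indicators of [d, e] and (0, 2 e), as weak convergence only
    tests continuous functions. It vanishes at 0, where the constant eigenvectors put mass. *)
Let plateau (d e : R) : R -> R := (cst 1) \min ((cst 0) \max
  ((fun x => x / d) \min (fun x => 2 - x / e))).

Let plateau_continuous d e : continuous (plateau d e).
Proof.
apply: min_fun_continuous; first exact: cst_continuous.
apply: max_fun_continuous; first exact: cst_continuous.
apply: min_fun_continuous => x; first exact: mulrr_continuous.
by apply: cvgB; [exact: cvg_cst|exact: mulrr_continuous].
Qed.

Let plateau_ge0 d e x : 0 <= plateau d e x.
Proof. by rewrite /plateau /= le_min ler01 /= le_max lexx. Qed.

Let plateau_le1 d e x : plateau d e x <= 1.
Proof. by rewrite /plateau /= ge_min lexx. Qed.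

Let plateau_bounded d e : bounded_fun (plateau d e).
Proof.
exists 1; split; first exact: num_real.
by move=> M M1 x _ /=; rewrite ger0_norm // (le_trans (plateau_le1 d e x)) // ltW.
Qed.

Let plateau_eq1 d e x : 0 < d -> 0 < e -> d <= x <= e -> plateau d e x = 1.
Proof.
move=> d0 e0 /andP[dx xe]; apply/eqP; rewrite eq_le plateau_le1 /plateau /= le_min lexx /=.
rewrite le_max le_min ler_pdivlMr // mul1r dx /= lerBrDl.
by rewrite -lerBrDr (_ : 2 - 1 = 1) ?ler_pdivrMr ?mul1r ?xe ?orbT //; lra.
Qed.

Let plateau_eq0 d e x : 0 < d -> 0 < e -> ~~ (0 < x < 2 * e) -> plateau d e x = 0.
Proof.
move=> d0 e0 xo; apply/eqP; rewrite eq_le plateau_ge0 andbT /plateau /= ge_min; apply/orP; right.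
rewrite ge_max lexx /= ge_min; move: xo; rewrite negb_and -!leNgt => /orP[x0|ex].
  by rewrite ler_pdivrMr // mul0r x0.
by rewrite subr_le0 ler_pdivlMr // ex orbT.
Qed.

Let plateau_measurable d e : measurable_fun (setT : set T) ((EFin \o plateau d e) : T -> \bar R).
Proof.
apply/measurable_EFinP; apply: continuous_measurable_fun.
exact: plateau_continuous.
Qed.

Let measurable_itvT (i : interval R) : measurable ([set` i] : set T).
Proof. exact: measurable_itv. Qed.

Let measure_indic (nu : {measure set T -> \bar R}) (A : set T) :
  measurable A -> (\int[nu]_x (\1_A x)%:E = nu A)%E.
Proof. by move=> mA; rewrite integral_indic // setIT. Qed.

Let integral_plateau_le (nu : {measure set T -> \bar R}) d e : 0 < d -> 0 < e ->
  (\int[nu]_x (plateau d e x)%:E <= nu `]0%R, (2 * e)%R[%classic)%E.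
Proof.
move=> d0 e0; have mA := measurable_itvT `]0%R, (2 * e)%R[.
have <- := measure_indic nu mA.
apply: ge0_le_integral => //.
- by move=> x _; rewrite lee_fin.
- exact: plateau_measurable.
- by apply/measurable_EFinP; apply: measurable_indic.
move=> x _; rewrite lee_fin indicE.
have [xi|xi] := boolP (x \in _) => //=.
rewrite plateau_eq0 //; apply: contra xi => xi; apply/mem_set.
by rewrite /= in_itv.
Qed.

Let le_integral_plateau (nu : {measure set T -> \bar R}) d e (A : set T) : 0 < d -> 0 < e ->
  measurable A -> A `<=` `[d, e] ->
  (nu A <= \int[nu]_x (plateau d e x)%:E)%E.
Proof.
move=> d0 e0 mA Ade; have <- := measure_indic nu mA.
apply: ge0_le_integral => //.
- by apply/measurable_EFinP; apply: measurable_indic.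
- exact: plateau_measurable.
move=> x _; rewrite lee_fin indicE.
have [/set_mem xA|xi] := boolP (x \in A) => //=.
by have := Ade _ xA; rewrite /= in_itv /= => /plateau_eq1 ->.
Qed.

(** The trapezoid transfers the bound; the factor 2 lost in the right end point only affects the
    constants. *)
Lemma weak_limit_le (d e : R) (c : \bar R) N0 : 0 < d -> 0 < e ->
  (forall N, (N0 <= N)%N -> (mu_ N `]0%R, (2 * e)%R[%classic <= c)%E) ->
  (mu `[d, e]%classic <= c)%E.
Proof.
move=> d0 e0 H; apply: le_trans (_ : (\int[mu]_x (plateau d e x)%:E <= c)%E).
  exact: le_integral_plateau.
apply: (cvge_to_le (mu_cvg (@plateau_continuous d e) (@plateau_bounded d e))).
exists N0 => // N /= NN; exact: le_trans (integral_plateau_le _ d0 e0) (H _ NN).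
Qed.

Lemma weak_limit_ge (d e : R) (c : \bar R) N0 : 0 < d -> d <= e ->
  (forall N, (N0 <= N)%N -> (c <= mu_ N [set d])%E) ->
  (c <= mu `]0%R, (2 * e)%R[%classic)%E.
Proof.
move=> d0 de H; have e0 : 0 < e by exact: lt_le_trans de.
apply: le_trans (integral_plateau_le mu d0 e0).
apply: (cvge_to_ge (mu_cvg (@plateau_continuous d e) (@plateau_bounded d e))).
exists N0 => // N /= NN; apply: le_trans (H _ NN) _.
apply: le_integral_plateau => // x /= ->; by rewrite in_itv /= lexx.
Qed.

(** Continuity from below along the intervals [1/(n + 1), e], since the trapezoid requires d > 0. *)
Lemma measure_itvoc_le (e : R) (c : \bar R) : 0 < e ->
  (forall d, 0 < d -> (mu `[d, e]%classic <= c)%E) -> (mu `]0%R, e]%classic <= c)%E.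
Proof.
move=> e0 H; pose F (n : nat) : set T := `[n.+1%:R^-1, e]%classic.
have FE : `]0%R, e]%classic = \bigcup_n F n.
  apply/seteqP; split => x /=.
    rewrite in_itv /= => /andP[x0 xe]; exists (Num.truncn x^-1) => //=.
    rewrite /F /= in_itv /= xe andbT -[leRHS]invrK lef_pV2 ?posrE ?invr_gt0 //.
    by apply: ltW; exact: truncnS_gt.
  case=> n _; rewrite /F /= !in_itv /= => /andP[nx ->]; rewrite andbT.
  by apply: lt_le_trans nx; rewrite invr_gt0.
rewrite FE.
have := @nondecreasing_cvg_mu _ _ _ mu F (fun n => measurable_itvT _).
rewrite -FE => /(_ (measurable_itvT _)) h.
have /h {}h : nondecreasing_seq F.
  move=> m n mn; apply/subsetPset => x; rewrite /F /= !in_itv /= => /andP[mx ->].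
  rewrite andbT; apply: le_trans mx; rewrite lef_pV2 ?posrE // ler_nat ltnS.
  exact: mn.
apply: (cvge_to_le h); exists 0%N => // n _ /=; apply: H.
by rewrite invr_gt0.
Qed.

End WeakLimit.

(** * The size of the path eigenvalue and the choice of the constants *)

Lemma sin_le_id (R : realType) (x : R) : 0 <= x -> sin x <= x.
Proof.
move=> x0; have [c _] := @MVT_segment R sin cos 0 x x0 (fun y _ => is_derive_sin y)
  (continuous_subspaceT (@continuous_sin R)).
by rewrite sin0 !subr0 => ->; rewrite ler_piMl // cos_le1.
Qed.

Lemma path_eigenvalue_bounds (R : realType) m : (0 < m)%N ->
  0 < path_eigenvalue R m <= 16 / m.+1%:R ^+ 2.
Proof.
move=> m0; have l0 : 0 < m.+1%:R :> R by [].
have x0 : 0 < pi / m.+1%:R :> R by rewrite divr_gt0 // pi_gt0.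
have xpi : pi / m.+1%:R <= pi :> R.
  by rewrite ler_pdivrMr // ler_peMr ?pi_ge0 // ler1n.
apply/andP; split.
  rewrite /path_eigenvalue subr_gt0 gtr_pMr //.
  have i0 : 0 \in `[0, pi : R] by rewrite in_itv /= lexx pi_ge0.
  have ix : pi / m.+1%:R \in `[0, pi : R] by rewrite in_itv /= (ltW x0) xpi.
  by rewrite -[ltRHS]cos0 ltr_cos.
set y := pi / m.+1%:R / 2 :> R.
have y0 : 0 <= y by rewrite divr_ge0 // ltW.
(* The half-angle formula, after which sin y <= y and pi / 2 < 2 give the bound 4 (2 / L)^2. *)
have -> : path_eigenvalue R m = 4 * sin y ^+ 2.
  rewrite /path_eigenvalue (_ : pi / m.+1%:R = y *+ 2); last by rewrite -[RHS]mulr_natr divfK.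
  by rewrite cos_mulr2n cos2sin2 -[_ *+ 2]mulr_natl; ring.
have s0 : 0 <= sin y.
  by rewrite sin_ge0_pi // y0 /= /y ler_pdivrMr // (le_trans xpi) // ler_peMr ?pi_ge0 // ler1n.
have : sin y ^+ 2 <= y ^+ 2 by rewrite lerXn2r ?nnegrE ?sin_le_id.
have yl : y <= 2 / m.+1%:R.
  by rewrite /y mulrAC ler_wpM2r ?invr_ge0 //; exact/ltW/pihalf_lt2.
have : y ^+ 2 <= (2 / m.+1%:R) ^+ 2.
  by apply: lerXn2r yl; rewrite nnegrE // divr_ge0.
rewrite [(2 / _) ^+ 2]exprMn exprVn; set z := (_ ^+ 2)^-1; lra.
Qed.

Theorem theorem1p4 (R : realType) (lambda : R)
    (sigma : probability (measurableTypeR R) R) :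
  1 < lambda -> is_dos lambda sigma ->
  exists E0 c c' : R, [/\ 0 < E0, 0 < c, c <= c' &
    forall E : R, 0 < E <= E0 ->
      ((expR (- c' * E `^ (- 2^-1)))%:E <= sigma `]0%R, E]%classic
        <= (expR (- c * E `^ (- 2^-1)))%:E)%E].
Proof.
move=> lam1 dos; have [gam [K1 [L0 [gam0 K10 upper]]]] := dos_N_upper lam1.
(* For E <= B^-2 the quantity y = E^(-1/2) is at least B. The three summands then ensure y >= 16, L0
   <= y / 16, and that [K1] is absorbed by half of the exponent. *)
pose B := 16 + 16 * L0%:R + 32 / gam * `|ln K1 + gam|.
have B16 : 16 <= B.
  rewrite /B -addrA lerDl addr_ge0 ?mulr_ge0 //.
  by rewrite invr_ge0 ltW.
have B0 : 0 < B by apply: lt_le_trans B16.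
exists (B ^- 2), (gam / 32), (Num.max (gam / 32) (7 * (2 + 2 * lambda))); split.
- by rewrite invr_gt0 exprn_gt0.
- by rewrite divr_gt0.
- by rewrite le_max lexx.
move=> E /andP[E0 EB]; pose r := Num.sqrt E.
have r0 : 0 < r by rewrite sqrtr_gt0.
have rE : E = r ^+ 2 by rewrite sqr_sqrtr // ltW.
have -> : E `^ (- 2^-1) = r^-1 by rewrite powRN powR12_sqrt // ltW.
set y := r^-1; have y0 : 0 < y by rewrite invr_gt0.
have ry : r * y = 1 by rewrite divff // gt_eqF.
have yB : B <= y.
  rewrite -[leLHS]invrK lef_pV2 ?posrE ?invr_gt0 //.
  move: EB; rewrite rE -exprVn ler_pXn2r ?nnegrE ?invr_ge0 // ltW //.
have y16 : 16 <= y by exact: le_trans yB.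
apply/andP; split.
  (* The path length m + 1 > 6 y makes its eigenvalue at most 16 E / 36 <= E / 2, while m + 1 <= 7 y
     yields the constant 7 (2 + 2 lambda) in c'. *)
  pose m := Num.truncn (6 * y); have m0 : (0 < m)%N.
    rewrite -ltnS -(ltr_nat R); apply: lt_trans (truncnS_gt _); lra.
  have my : 6 * y < m.+1%:R by exact: truncnS_gt.
  have ym : m.+1%:R <= 7 * y.
    have : m%:R <= 6 * y by rewrite truncn_le mulr_ge0 // ltW.
    by rewrite -natr1; lra.
  have /andP[mu0 mu_le] := path_eigenvalue_bounds R m0.
  have muE : path_eigenvalue R m <= E / 2.
    apply: (le_trans mu_le); rewrite ler_pdivrMr ?exprn_gt0 //.
    have : 1 * 36 <= E * m.+1%:R ^+ 2.
      apply: (@le_trans _ _ (E * (6 * y) ^+ 2)).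
        by rewrite rE exprMn mulrCA -exprMn ry; lra.
      by rewrite ler_wpM2l ?(ltW E0) // lerXn2r ?nnegrE ?mulr_ge0 // ltW.
    lra.
  have [N0 lower] := dos_N_lower lam1 m0.
  have := weak_limit_ge dos mu0 muE lower.
  rewrite [2 * (E / 2)]mulrC divfK // => h; apply: (@le_trans _ _ (sigma `]0%R, E[%classic)); last first.
    apply: le_measure; rewrite ?inE; [exact: measurable_itv|exact: measurable_itv|].
    by move=> x /=; rewrite !in_itv /= => /andP[-> /ltW].
  apply: le_trans h; rewrite lee_fin ler_expR mulNr lerN2.
  apply: (@le_trans _ _ (7 * (2 + 2 * lambda) * y)).
    rewrite (mulrC 7) -mulrA ler_wpM2l //; lra.
  by rewrite ler_wpM2r ?(ltW y0) // le_max lexx orbT.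
(* As y >= 16, this gives 3 L + 1 <= y / 4 and hence 8 (3 L + 1)^2 (2 E) <= 1. The energy is 2 E to
   make up for the loss in [weak_limit_le]. *)
pose L := Num.truncn (y / 16).
have yL : y / 16 < L%:R + 1 by rewrite natr1; exact: truncnS_gt.
have y16_ge0 : 0 <= y / 16 by rewrite divr_ge0 // ltW.
have Ly : L%:R <= y / 16 by rewrite truncn_le.
have nrm0 : 0 <= 32 / gam * `|ln K1 + gam| by rewrite mulr_ge0 // divr_ge0 // ltW.
have L00 : 0 <= L0%:R :> R by [].
have L0L : (L0 <= L)%N.
  by rewrite truncn_ge_nat // ler_pdivlMr //; move: yB; rewrite /B; lra.
have L1 : 1 <= L%:R :> R by rewrite ler1n truncn_gt0 ler_pdivlMr // mul1r.
have EL : 8 * (3 * L + 1)%:R ^+ 2 * (2 * E) <= 1.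
  have : (3 * L + 1)%:R <= y / 4 by rewrite natrD natrM; lra.
  move=> /(lerXn2r 2 (ler0n _ _) (divr_ge0 (ltW y0) (ler0n _ 4))).
  have e16 : (y / 4) ^+ 2 * E = 16^-1.
    by rewrite rE -exprMn mulrAC (mulrC y) ry; field.
  by move=> /(ler_wpM2r (ltW E0)); rewrite e16; lra.
have [N0 HN] := upper L (2 * E) L0L (mulr_gt0 (ltr0Sn R 1) E0) EL.
(* Since gam L >= gam y / 16 - gam, half of gam y / 16 remains after the other half has absorbed ln
   K1 + gam. *)
have K1y : K1 * expR (- (gam * L%:R)) <= expR (- (gam / 32) * y).
  rewrite -[X in X * _](lnK K10) -expRD ler_expR.
  have h1 : gam * (y / 16) <= gam * (L%:R + 1) by rewrite ler_wpM2l // ltW.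
  have h2 : gam / 32 * (32 / gam * `|ln K1 + gam|) <= gam / 32 * y.
    rewrite ler_wpM2l ?divr_ge0 // ltW //; move: yB; rewrite /B; lra.
  have h3 : gam / 32 * (32 / gam * `|ln K1 + gam|) = `|ln K1 + gam|.
    by field; rewrite gt_eqF.
  have := ler_norm (ln K1 + gam); move: h1 h2; rewrite h3; lra.
apply: measure_itvoc_le => // d d0; apply: le_trans (weak_limit_le dos d0 E0 HN) _.
by rewrite lee_fin.
Qed.
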